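(* Let $\mathcal T$ be the $(2,2)$-substitution (the Table) on $\mathcal A=\{0,1,2,3\}$ in $\mathbb Z^2$ given by $$0\mapsto\begin{matrix}3&0\\1&0\end{matrix},\qquad 1\mapsto\begin{matrix}1&1\\0&2\end{matrix},\qquad 2\mapsto\begin{matrix}2&3\\2&1\end{matrix},\qquad 3\mapsto\begin{matrix}0&2\\3&3\end{matrix},$$ where in each $2\times2$ block the bottom-left, bottom-right, top-left and top-right entries are at positions $(0,0)$, $(1,0)$, $(0,1)$, $(1,1)$ respectively. Then the spectrum of $\mathcal T$ is singular to Lebesgue measure: the maximal spectral type $\sigma_{\max}$ of the uniquely ergodic $\mathbb Z^2$-subshift $(X_{\mathcal T},T)$ is singular with respect to Lebesgue measure on the two-torus $\mathbb T^2$.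
   Context: A block is a map from a finite subset of $\mathbb Z^2$ to $\mathcal A$. The substitution extends to blocks and sequences by $(\mathcal T\omega)(\mathbf b+2\mathbf a)=\mathcal T(\omega(\mathbf a))(\mathbf b)$ for $\mathbf b\in\{0,1\}^2$, $\mathbf a\in\mathbb Z^2$. $X_{\mathcal T}\subset\mathcal A^{\mathbb Z^2}$ is the set of sequences all of whose finite sub-blocks occur, up to translation, as sub-blocks of some $\mathcal T^n(\gamma)$, $n\in\mathbb N$, $\gamma\in\mathcal A$, and $T$ is the $\mathbb Z^2$-shift $(T^{\mathbf k}A)(\mathbf j)=A(\mathbf j+\mathbf k)$; $\mu$ denotes the unique $T$-invariant Borel probability measure on $X_{\mathcal T}$. For $f\in L^2(\mu)$, $\sigma_f$ is the positive measure on $\mathbb T^2$ with $\int z_1^{-k_1}z_2^{-k_2}\,d\sigma_f=\int f\circ T^{-\mathbf k}\,\overline f\,d\mu$ for $\mathbf k\in\mathbb Z^2$. The maximal spectral type $\sigma_{\max}$ is the type (mutual absolute continuity class) of $\sigma_F$ for $F\in L^2(\mu)$ such that $\sigma_f\ll\sigma_F$ for all $f\in L^2(\mu)$. *)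

(* Defs.v *)
From HB Require Import structures.
From mathcomp Require Import all_boot all_order all_algebra finmap complex.
From mathcomp Require Import all_classical all_reals all_analysis.

Set Implicit Arguments.
Unset Strict Implicit.
Unset Printing Implicit Defensive.

Import Order.TTheory GRing.Theory Num.Theory numFieldNormedType.Exports.

Local Open Scope classical_set_scope.
Local Open Scope ring_scope.
Local Open Scope complex_scope.

Definition letter : Type := 'I_4.
HB.instance Definition _ := Finite.on letter.
HB.instance Definition _ := isPointed.Build letter ord0.

Definition a0 : letter := @Ordinal 4 0 isT.
Definition a1 : letter := @Ordinal 4 1 isT.
Definition a2 : letter := @Ordinal 4 2 isT.
Definition a3 : letter := @Ordinal 4 3 isT.

(* A position b in {0,1}^2 is a pair of booleans (horizontal, vertical), [true]
   standing for 1.  The arguments are in reading order: top row, bottom row. *)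
Definition square (tl tr bl br : letter) (b : bool * bool) : letter :=
  match b with
  | (false, false) => bl | (true, false) => br
  | (false, true)  => tl | (true, true)  => tr
  end.

Definition table (g : letter) : bool * bool -> letter :=
  match val g with
  | 0%N => square a3 a0
                  a1 a0
  | 1%N => square a1 a1
                  a0 a2
  | 2%N => square a2 a3
                  a2 a1
  | _   => square a0 a2
                  a3 a3
  end.

(* Partial configurations on Z^2; a block is one whose domain (the positions
   carrying [Some] letter) is finite. *)
Definition pconfig := int * int -> option letter.

Definition single (g : letter) : pconfig :=
  fun j => if j == 0 then Some g else None.

(* Every j in Z^2 is b + 2a for exactly one b in {0,1}^2 and a in Z^2:
   b is the parity of j and a its (floor) quotient by 2. *)
Definition subst_ext (S : letter -> bool * bool -> letter) (w : pconfig) :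
    pconfig :=
  fun j => omap (fun g => S g ((j.1 %% 2)%Z == 1, (j.2 %% 2)%Z == 1))
                (w ((j.1 %/ 2)%Z, (j.2 %/ 2)%Z)).

(* The full shift A^(Z^2), with the product of discrete topologies and its
   Borel sigma-algebra. *)
Definition config := prod_topology (fun _ : int * int => discrete_topology letter).
Definition bconfig := g_sigma_algebraType (@open config).

Definition subshift (S : letter -> bool * bool -> letter) : set bconfig :=
  [set x | forall F : {fset int * int}, exists n g (t : int * int),
     forall k : int * int, k \in F ->
       iter n (subst_ext S) (single g) (k + t) = Some (x k)].

Definition zshift (k : int * int) (x : bconfig) : bconfig := fun j => x (j + k).

(* Invariant Borel probability measures on a closed subset X of the full shift
   are seen as invariant Borel probability measures on the full shift giving
   full mass to X. *)
Definition invariant_probability_on (R : realType) (X : set bconfig)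
    (mu : probability bconfig R) : Prop :=
  mu X = 1%E /\
  forall (k : int * int) (B : set bconfig), measurable B ->
    mu (zshift k @^-1` B) = mu B.

Definition cintegral d (T : measurableType d) (R : realType)
    (m : {measure set T -> \bar R}) (f : T -> R[i]) : R[i] :=
  Rintegral m setT (fun x => complex.Re (f x)) +i*
  Rintegral m setT (fun x => complex.Im (f x)).

Definition L2 d (T : measurableType d) (R : realType)
    (m : {measure set T -> \bar R}) (f : T -> R[i]) : Prop :=
  [/\ measurable_fun setT (fun x => complex.Re (f x)),
      measurable_fun setT (fun x => complex.Im (f x)) &
      (\int[m]_x ((Normc.normc (f x)) ^+ 2)%:E < +oo)%E].

(* The two-torus in angular coordinates: t in [0,1[^2 stands for
   (z_1, z_2) = (e^(2 i pi t_1), e^(2 i pi t_2)). *)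
Definition torus {R : realType} : set (R * R) := `[0, 1[ `*` `[0, 1[.

Definition circle_pt (R : realType) (t : R) : R[i] :=
  cos (2 * pi * t) +i* sin (2 * pi * t).

Definition torus_lebesgue (R : realType) (A : set (R * R)) : \bar R :=
  (lebesgue_measure \x lebesgue_measure)%E (A `&` @torus R).

Definition torus_measure (R : realType)
    (s : {finite_measure set (R * R)%type -> \bar R}) : Prop :=
  s (~` torus) = 0%E.

Definition spectral_measure (R : realType) (mu : probability bconfig R)
    (f : bconfig -> R[i])
    (s : {finite_measure set (R * R)%type -> \bar R}) : Prop :=
  torus_measure s /\
  forall k : int * int,
    cintegral s (fun t => circle_pt t.1 ^ (- k.1) * circle_pt t.2 ^ (- k.2)) =
    cintegral mu (fun x => f (zshift (- k) x) * conjc (f x)).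

(* [s] is one of the measures of the class sigma_max. *)
Definition in_maximal_spectral_type (R : realType) (mu : probability bconfig R)
    (s : {finite_measure set (R * R)%type -> \bar R}) : Prop :=
  torus_measure s /\
  exists (F : bconfig -> R[i])
         (sF : {finite_measure set (R * R)%type -> \bar R}),
    [/\ L2 mu F, spectral_measure mu F sF,
        forall (f : bconfig -> R[i])
               (sf : {finite_measure set (R * R)%type -> \bar R}),
          L2 mu f -> spectral_measure mu f sf -> sf `<< sF,
        s `<< sF & sF `<< s].

Definition mutually_singular d (T : measurableType d) (R : realType)
    (m1 m2 : set T -> \bar R) : Prop :=
  exists N : set T, [/\ measurable N, m1 N = 0%E & m2 (~` N) = 0%E].

(* Main.v *)
Require Import Defs.
From mathcomp Require Import all_boot all_order all_algebra finmap complex.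
From mathcomp Require Import all_classical all_reals all_analysis.
From mathcomp Require Import measurable_realfun ring lra zify.

(* Let U be the shift by (1, 0), P_N = (1/N) (U^(2^N) + ... + U^(2^(2N-1))) and
   Q_N = (P_N - 1)(P_N + 1/15).  Each position of the 2x2 blocks acts on the
   letters by a permutation, so a translation by (2^n, 0) preserves the position
   in the supertiles of level at most n, and the correlations at (2^n, 0) of
   mean zero functions of the letter are those at (1, 0), which are -1/15 times
   the variance; the correlations at (2^n - 2^m, 0) tend to (-1/15)^2 times it.
   Hence P_N tends strongly to 1 on the functions of the position, to -1/15 on
   the mean zero functions of the letter at each level, and Q_N F tends to 0 for
   every F in L^2(mu).  In other words the trigonometric polynomials Q_N tend to
   0 in L^2(sigma_F), while P_N tends to 0 in L^2(Lebesgue), so that |Q_N| tends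
   to 1/15 in Lebesgue measure: the two measures are mutually singular.

   Recognizability and unique ergodicity are not needed: by invariance, the
   integral of a nonnegative function is that of its averages over large
   windows, and every window of a point of the subshift is covered by four
   supertiles. *)

Set Implicit Arguments.
Unset Strict Implicit.
Unset Printing Implicit Defensive.

Import Order.TTheory GRing.Theory Num.Theory numFieldNormedType.Exports.

(** * Supertiles *)

Section Supertiles.
Local Open Scope nat_scope.

(** Why the correlations at (2^n - 2^m, 0) tend to the square: up to scale this is a translation by
    2^d - 1 columns, which sends all columns but the first of a supertile of type u into the next
    one, of type v, one column to the left. The mean product there must tend to -1/15 times the
    centred indicator of u = v, for all pairs (u, v). On the diagonal the recursion in d closes up
    and is solved exactly. Off the diagonal, the four position permutations are the transpositions
    (0 1), (1 2), (2 3), (0 3), and their average contracts matrices with zero row and column sums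
    and a small diagonal. Averaging over neighbouring types then multiplies by -1/15 a second time.
    The letter indicators have total variance 3/4, so the two limits read -1/20 and 1/300, and the
    squared norm of P_N + 1/15 tends to 1/300 - 2/300 + 1/300 = 0. Averaging over N exponents makes
    the pairs with n - m small, whose correlations need not be near the limit, negligible; the
    exponents start at N in order to exceed every fixed level. *)

Lemma letter_ind (P : letter -> Prop) :
  P a0 -> P a1 -> P a2 -> P a3 -> forall g, P g.
Proof.
move=> h0 h1 h2 h3 [[|[|[|[|m]]]] hm] //.
- by rewrite (_ : Ordinal hm = a0) //; apply: val_inj.
- by rewrite (_ : Ordinal hm = a1) //; apply: val_inj.
- by rewrite (_ : Ordinal hm = a2) //; apply: val_inj.
- by rewrite (_ : Ordinal hm = a3) //; apply: val_inj.
Qed.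

Lemma table_inj b : injective (table^~ b).
Proof.
by case: b => [[] []]; elim/letter_ind; elim/letter_ind => // /(congr1 val).
Qed.

(* Only the M lowest binary digits of i and j are read: this is the supertile
   T^M(g) extended 2^M-periodically. *)
Fixpoint tile (M : nat) (g : letter) (i j : nat) : letter :=
  if M is M'.+1 then table (tile M' g i./2 j./2) (odd i, odd j) else g.

Lemma tile_add m n g i j :
  tile (m + n) g i j = tile m (tile n g (i %/ 2 ^ m) (j %/ 2 ^ m)) i j.
Proof.
elim: m i j => [|m IH] i j /=; first by rewrite !divn1.
by rewrite IH -!divn2 -!divnMA -!expnS.
Qed.

(** A fixed position in a supertile acts on its type by a composition of the permutations of the
    table; hence [kap] takes the same value on two types as on the letters they put at that
    position. *)
Lemma tile_inj M i j : injective (fun g => tile M g i j).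
Proof.
elim: M i j => [|M IH] i j u v //= e.
exact/(IH i./2 j./2)/(table_inj e).
Qed.

Lemma tile_periodic M g i j p q :
  tile M g (2 ^ M * p + i) (2 ^ M * q + j) = tile M g i j.
Proof.
elim: M i j => [|M IH] i j //=.
by rewrite !expnS -!mulnA !mul2n !halfD !odd_double !doubleK !oddD !odd_double /= !add0n IH.
Qed.

Lemma tile_split m n g i j b c : b < 2 ^ m -> c < 2 ^ m ->
  tile (m + n) g (2 ^ m * i + b) (2 ^ m * j + c) = tile m (tile n g i j) b c.
Proof.
move=> hb hc; rewrite tile_add tile_periodic.
by rewrite !(mulnC (2 ^ m)) !divnMDl ?expn_gt0// !divn_small// !addn0.
Qed.

End Supertiles.

(** * Means over squares *)

Section Means.
Variable R : realFieldType.
Local Open Scope ring_scope.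
Implicit Types (D E : nat -> nat -> R) (f : nat -> R).

Definition mean L D : R :=
  (\sum_(0 <= i < L) \sum_(0 <= j < L) D i j) / (L%:R ^+ 2).

Lemma eq_mean L D E : (forall i j, (i < L)%N -> (j < L)%N -> D i j = E i j) ->
  mean L D = mean L E.
Proof.
move=> h; congr (_ / _); apply: eq_big_nat => i /andP[_ hi].
by apply: eq_big_nat => j /andP[_ hj]; apply: h.
Qed.

Lemma le_mean L D E : (forall i j, (i < L)%N -> (j < L)%N -> D i j <= E i j) ->
  mean L D <= mean L E.
Proof.
move=> h; rewrite ler_wpM2r ?invr_ge0 ?exprn_ge0//.
by apply: ler_sum_nat => i /andP[_ hi]; apply: ler_sum_nat => j /andP[_ hj]; apply: h.
Qed.

Lemma meanD L D E : mean L (fun i j => D i j + E i j) = mean L D + mean L E.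
Proof.
rewrite /mean -mulrDl -big_split; congr (_ / _).
by apply: eq_bigr => i _; rewrite big_split.
Qed.

Lemma meanZ L c D : mean L (fun i j => c * D i j) = c * mean L D.
Proof.
rewrite /mean mulrA mulr_sumr; congr (_ / _).
by apply: eq_bigr => i _; rewrite mulr_sumr.
Qed.

Lemma mean_sum (I : Type) (r : seq I) L (D : I -> nat -> nat -> R) :
  mean L (fun i j => \sum_(k <- r) D k i j) = \sum_(k <- r) mean L (D k).
Proof.
elim: r => [|k r IH].
  under eq_mean do rewrite big_nil.
  rewrite big_nil /mean big1 ?mul0r// => i _; exact: big1.
by under eq_mean do rewrite big_cons; rewrite meanD IH big_cons.
Qed.

Lemma mean_cst L (c : R) : (0 < L)%N -> mean L (fun _ _ => c) = c.
Proof.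
move=> L0; rewrite /mean !sumr_const_nat subn0 -mulrnA -[c *+ _]mulr_natr natrM -expr2 mulfK//.
by rewrite sqrf_eq0 pnatr_eq0 -lt0n.
Qed.

Lemma mean_ge0 L D : (forall i j, 0 <= D i j) -> 0 <= mean L D.
Proof.
by move=> h; rewrite divr_ge0 ?exprn_ge0// sumr_ge0// => i _; rewrite sumr_ge0.
Qed.

Lemma sum_nat_mul a q f :
  \sum_(0 <= i < a * q) f i = \sum_(0 <= i < q) \sum_(0 <= b < a) f (a * i + b)%N.
Proof.
elim: q => [|q IH]; first by rewrite muln0 !big_geq.
rewrite big_nat_recr//= -IH mulnS addnC (@big_cat_nat _ _ _ (a * q)%N 0%N)//= ?leq_addr//.
congr (_ + _); rewrite -{1}[(a * q)%N]add0n big_addn.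
by rewrite addKn; apply: eq_bigr => i _; rewrite addnC.
Qed.

Lemma mean_mul a q D :
  mean (a * q) D =
  mean q (fun i j => mean a (fun b c => D (a * i + b)%N (a * j + c)%N)).
Proof.
rewrite /mean natrM exprMn invfM mulrA; congr (_ / _).
rewrite mulr_suml sum_nat_mul; apply: eq_bigr => i _.
rewrite -mulr_suml; under eq_bigr do rewrite sum_nat_mul.
by rewrite exchange_big/= mulr_suml.
Qed.

Lemma mean_shift L D : (forall i j, D (L + i)%N j = D i j) ->
  mean L (fun i j => D i.+1 j) = mean L D.
Proof.
move=> h; congr (_ / _); case: L h => [|L] h; first by rewrite !big_geq.
rewrite big_nat_recr//= [RHS]big_nat_recl//= addrC; congr (_ + _).
by apply: eq_bigr => j _; rewrite -[L.+1]addn0 h.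
Qed.

Lemma mean_shiftn L D k : (forall i j, D (L + i)%N j = D i j) ->
  mean L (fun i j => D (i + k)%N j) = mean L D.
Proof.
move=> h; elim: k => [|k IH]; first by apply: eq_mean => i j _ _; rewrite addn0.
rewrite -IH -(@mean_shift _ (fun i j => D (i + k)%N j)).
  by apply: eq_mean => i j _ _; rewrite addnS addSn.
by move=> i j; rewrite -addnA h.
Qed.

End Means.

(** * Recursions for the correlations of neighbouring columns *)

Section Correlations.
Variable R : realFieldType.
Local Open Scope ring_scope.

(** The matrix of the orthogonal projection onto the mean zero functions of the letter, see
    [sum_kap]. *)
Definition kap (u v : letter) : R := (u == v)%:R - 4^-1.

(* Contributions of the first column (whose left neighbour lies in the adjacent
   supertile) and of the other columns to the correlation of a supertile of
   level d with its translate by (1, 0), see [mean_alpha] and [mean_beta]; the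
   recursion removes the highest binary digit of the position. *)
Fixpoint alpha (d : nat) (u v : letter) : R :=
  if d is d'.+1 then
    (alpha d' (table u (false, false)) (table v (true, false)) +
     alpha d' (table u (false, true)) (table v (true, true))) / 4
  else kap u v.

Fixpoint beta (d : nat) (u v : letter) : R :=
  if d is d'.+1 then
    (beta d' (table u (false, false)) (table v (false, false)) +
     beta d' (table u (false, true)) (table v (false, true)) +
     beta d' (table u (true, false)) (table v (true, false)) +
     beta d' (table u (true, true)) (table v (true, true)) +
     alpha d' (table u (true, false)) (table v (false, false)) +
     alpha d' (table u (true, true)) (table v (false, true))) / 4
  else 0.

Lemma kap_inj (f : letter -> letter) u v : injective f -> kap (f u) (f v) = kap u v.
Proof. by move=> f_inj; rewrite /kap (inj_eq f_inj). Qed.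

Lemma kapC u v : kap u v = kap v u.
Proof. by rewrite /kap eq_sym. Qed.

Lemma kapxx u : kap u u = 3 / 4.
Proof. by rewrite /kap eqxx /=; lra. Qed.

Lemma normr_kap u v : `|kap u v| <= 3 / 4.
Proof. by rewrite /kap; case: eqP => _ /=; rewrite ler_norml; lra. Qed.

Lemma normr_alpha d u v : `|alpha d u v| <= 3 / 4 * 2^-1 ^+ d.
Proof.
elim: d u v => [|d IH] u v /=; first by rewrite mulr1 normr_kap.
have := IH (table u (false, false)) (table v (true, false)).
have := IH (table u (false, true)) (table v (true, true)).
by rewrite !ler_norml exprS; lra.
Qed.

(** Each position permutes the letters, so the recursion only rearranges a sum over all letters, and
    the rows of [kap] sum to 0. *)
Lemma alpha_row d u : alpha d u a0 + alpha d u a1 + alpha d u a2 + alpha d u a3 = 0.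
Proof.
elim: d u => [|d IH] u.
  by elim/letter_ind: u; rewrite /= /kap /=; lra.
rewrite /=; have := IH (table u (false, false)); have := IH (table u (false, true)).
by rewrite /table /=; lra.
Qed.

Lemma alpha_col d u : alpha d a0 u + alpha d a1 u + alpha d a2 u + alpha d a3 u = 0.
Proof.
elim: d u => [|d IH] u.
  by elim/letter_ind: u; rewrite /= /kap /=; lra.
rewrite /=; have := IH (table u (true, false)); have := IH (table u (true, true)).
by rewrite /table /=; lra.
Qed.

Lemma beta_row d u : beta d u a0 + beta d u a1 + beta d u a2 + beta d u a3 = 0.
Proof.
elim: d u => [|d IH] u; first by rewrite /= !addr0.
have := IH (table u (false, false)); have := IH (table u (false, true)).
have := IH (table u (true, false)); have := IH (table u (true, true)).
have := alpha_row d (table u (true, false)); have := alpha_row d (table u (true, true)).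
rewrite /= /table /=; lra.
Qed.

Lemma beta_col d u : beta d a0 u + beta d a1 u + beta d a2 u + beta d a3 u = 0.
Proof.
elim: d u => [|d IH] u; first by rewrite /= !addr0.
have := IH (table u (false, false)); have := IH (table u (false, true)).
have := IH (table u (true, false)); have := IH (table u (true, true)).
have := alpha_col d (table u (false, false)); have := alpha_col d (table u (false, true)).
rewrite /= /table /=; lra.
Qed.

(* Coefficients of the exact solution of the recursion satisfied by
   [alpha d u v + beta d u u], whose iterates span a three-dimensional space
   with eigenvalues 1, 1/2 and -1/4. *)
Definition coef_half (u v : letter) : R :=
  nth 0 (nth [::] [:: [:: 0; -20; 20; -20]; [:: 20; 40; 0; 0];
                      [:: -20; 0; 0; 0]; [:: 20; 0; 0; 40]] u) v.
Definition coef_quarter (u v : letter) : R :=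
  nth 0 (nth [::] [:: [:: 48; 8; -32; 8]; [:: -32; 8; -12; -12];
                      [:: 8; -12; 48; -12]; [:: -32; -12; -12; 8]] u) v.

(** Grouping the terms of the recursion shows that this combination at level d+1 is the average of
    four of its own values at level d, namely those recalled in the proof. The constant term is
    -1/15 times 3/4. *)
Lemma alpha_beta_diag d u v : alpha d u v + beta d u u =
  - 20^-1 + (coef_half u v * 2^-1 ^+ d + coef_quarter u v * (- 4^-1) ^+ d) / 60.
Proof.
elim: d u v => [|d IH] u v.
  by elim/letter_ind: u; elim/letter_ind: v;
    rewrite /= /kap /coef_half /coef_quarter /=; lra.
have hx := exprS (2^-1 : R) d; have hy := exprS (- 4^-1 : R) d.
move: hx hy (IH (table u (false, false)) (table v (true, false)))
  (IH (table u (false, true)) (table v (true, true)))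
  (IH (table u (true, false)) (table u (false, false)))
  (IH (table u (true, true)) (table u (false, true))).
move: (_ ^+ d.+1) (_ ^+ d) (_ ^+ d.+1) (_ ^+ d) => x' x y' y -> -> /=.
by elim/letter_ind: u; elim/letter_ind: v;
  rewrite /table /coef_half /coef_quarter /=; lra.
Qed.

Lemma alpha_beta_diag_near d u :
  `|alpha d u u + beta d u u + 20^-1| <= 2^-1 ^+ d.
Proof.
rewrite alpha_beta_diag.
have hx : `|(- 4^-1) ^+ d| <= 2^-1 ^+ d :> R.
  by rewrite normrX lerXn2r ?nnegrE//= ?normr_ge0//; rewrite normrN ger0_norm; lra.
move: hx; rewrite !ler_norml; set x := _ ^+ d; set y := _ ^+ d.
by elim/letter_ind: u; rewrite /coef_half /coef_quarter /=; lra.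
Qed.

(* The zero row and column sums make the average over the four column
   permutations a contraction in the sup norm. *)
Lemma table_average_contraction (h : letter -> letter -> R) (e B : R) u v :
  (forall w, h w a0 + h w a1 + h w a2 + h w a3 = 0) ->
  (forall w, h a0 w + h a1 w + h a2 w + h a3 w = 0) ->
  (forall w, `|h w w| <= e) -> (forall w w', `|h w w'| <= B) ->
  `|(h (table u (false, false)) (table v (false, false)) +
     h (table u (false, true)) (table v (false, true)) +
     h (table u (true, false)) (table v (true, false)) +
     h (table u (true, true)) (table v (true, true))) / 4| <= 3 / 4 * B + e.
Proof.
move=> row col diag bound.
have := row a0; have := row a1; have := row a2; have := row a3.
have := col a0; have := col a1; have := col a2; have := col a3.
have := diag a0; have := diag a1; have := diag a2; have := diag a3.
have := bound a0 a1; have := bound a0 a2; have := bound a0 a3.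
have := bound a1 a0; have := bound a1 a2; have := bound a1 a3.
have := bound a2 a0; have := bound a2 a1; have := bound a2 a3.
have := bound a3 a0; have := bound a3 a1; have := bound a3 a2.
clear row col diag bound.
elim/letter_ind: u; elim/letter_ind: v; rewrite /table /= !ler_norml => *; lra.
Qed.

End Correlations.

(** * Limits of the correlations at powers of 2 and at their differences *)

Section CorrelationLimits.
Variable R : realFieldType.
Local Open Scope ring_scope.
Local Notation kap := (@kap R).
Local Notation alpha := (@alpha R).
Local Notation beta := (@beta R).

Lemma beta_near d u v : `|beta d u v + 15^-1 * kap u v| <= 9 * (3 / 4) ^+ d.
Proof.
(* The subtracted term makes the induction close: the diagonal error and the two [alpha] terms add
   (7/4 + 3/8) 2^-d, and 3/4 * 17/2 - 17/8 = 1/2 * 17/2. The 9 leaves room for the case d = 0. *)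
suff: `|beta d u v + 15^-1 * kap u v| <= 9 * (3 / 4) ^+ d - 17 / 2 * 2^-1 ^+ d.
  by move=> /le_trans; apply; rewrite gerBl mulr_ge0// exprn_ge0.
elim: d u v => [|d IH] u v.
  rewrite /= add0r normrM ger0_norm// !expr0.
  by have := normr_kap R u v; lra.
pose h u v := beta d u v + 15^-1 * kap u v.
have row w : h w a0 + h w a1 + h w a2 + h w a3 = 0.
  have := beta_row R d w; rewrite /h; have := alpha_row R 0 w; rewrite /=; lra.
have col w : h a0 w + h a1 w + h a2 w + h a3 w = 0.
  have := beta_col R d w; rewrite /h; have := alpha_col R 0 w; rewrite /=; lra.
have diag w : `|h w w| <= 7 / 4 * 2^-1 ^+ d.
  have := alpha_beta_diag_near R d w; have := normr_alpha R d w w.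
  rewrite /h kapxx !ler_norml; lra.
have := table_average_contraction u v row col diag IH.
have := normr_alpha R d (table u (true, false)) (table v (false, false)).
have := normr_alpha R d (table u (true, true)) (table v (false, true)).
rewrite /h !(@kap_inj _ (table^~ _) _ _ (@table_inj _)).
by rewrite /= !exprS !ler_norml; lra.
Qed.

Definition nu M g k : R :=
  mean (2 ^ M) (fun i j => kap (tile M g i j) (tile M g (i + k)%N j)).

(** A translation by a multiple of 2^a columns keeps the position in the supertiles of level a, and
    a common position permutation does not change [kap]. *)
Lemma nu_mul a M g k : nu (a + M) g (2 ^ a * k) = nu M g k.
Proof.
rewrite /nu expnD mean_mul; apply: eq_mean => i j _ _.
rewrite -[RHS](@mean_cst _ (2 ^ a)) ?expn_gt0//; apply: eq_mean => b c hb hc.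
rewrite addnAC -mulnDr !tile_split// (@kap_inj _ (fun g => tile a g b c))//.
exact: tile_inj.
Qed.

Lemma mean2 (D : nat -> nat -> R) : mean 2 D = (D 0%N 0%N + D 0%N 1%N + D 1%N 0%N + D 1%N 1%N) / 4.
Proof. by rewrite /mean !big_nat_recr//= !big_geq//= !add0r; field. Qed.

Lemma tile_top d g (p q : bool) i j : (i < 2 ^ d)%N -> (j < 2 ^ d)%N ->
  tile d.+1 g (2 ^ d * p + i) (2 ^ d * q + j) = tile d (table g (p, q)) i j.
Proof.
move=> hi hj; rewrite -(addn1 d) (tile_split _ _ _ _ hi hj).
by rewrite /= !oddb.
Qed.

Lemma mean_alpha d u v :
  mean (2 ^ d) (fun i j => if i == 0%N then
    kap (tile d u 0 j) (tile d v (2 ^ d - 1) j) else 0) = alpha d u v.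
Proof.
elim: d u v => [|d IH] u v; first by rewrite /mean /= !big_nat1 expr1n divr1.
have L0 : (0 < 2 ^ d)%N by rewrite expn_gt0.
have step (p q : bool) : mean (2 ^ d) (fun b c => if (2 ^ d * p + b)%N == 0%N then
    kap (tile d.+1 u 0 (2 ^ d * q + c)) (tile d.+1 v (2 ^ d.+1 - 1) (2 ^ d * q + c))
    else 0) =
    if p then 0 else alpha d (table u (false, q)) (table v (true, q)).
  case: p.
    rewrite -[RHS](@mean_cst R (2 ^ d))//; apply: eq_mean => b c _ _.
    by rewrite muln1 addn_eq0 -leqn0 leqNgt L0.
  rewrite -IH; apply: eq_mean => b c hb hc; rewrite muln0 add0n.
  case: eqP => // b0.
  have := @tile_top d u false q 0 c L0 hc; rewrite muln0 add0n => ->.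
  have L1 : (2 ^ d - 1 < 2 ^ d)%N by rewrite subn1 prednK.
  rewrite -(@tile_top d v true q _ c L1 hc).
  by rewrite muln1 addnBA// addnn -mul2n -expnS.
rewrite {1}expnSr mean_mul mean2.
by rewrite (step false false) (step false true) (step true false) (step true true) /= !addr0.
Qed.

Lemma mean_beta d u v :
  mean (2 ^ d) (fun i j => if i == 0%N then 0 else
    kap (tile d u i j) (tile d v i.-1 j)) = beta d u v.
Proof.
elim: d u v => [|d IH] u v; first by rewrite /mean /= !big_nat1 mul0r.
have L0 : (0 < 2 ^ d)%N by rewrite expn_gt0.
have step (p q : bool) : mean (2 ^ d) (fun b c => if (2 ^ d * p + b)%N == 0%N then 0
    else kap (tile d.+1 u (2 ^ d * p + b) (2 ^ d * q + c))
             (tile d.+1 v (2 ^ d * p + b).-1 (2 ^ d * q + c))) =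
    beta d (table u (p, q)) (table v (p, q)) +
    if p then alpha d (table u (true, q)) (table v (false, q)) else 0.
  case: p; last first.
    rewrite addr0 -IH; apply: eq_mean => b c hb hc; rewrite muln0 add0n.
    case: eqP => // b0.
    have := @tile_top d u false q b c hb hc; rewrite muln0 add0n => ->.
    have b1 : (b.-1 < 2 ^ d)%N by lia.
    by have := @tile_top d v false q _ c b1 hc; rewrite muln0 add0n => ->.
  rewrite -IH -mean_alpha -meanD; apply: eq_mean => b c hb hc.
  rewrite !muln1 addn_eq0 eqn0Ngt L0 andFb.
  have := @tile_top d u true q b c hb hc; rewrite muln1 => ->.
  case: eqP => [->|b0].
    have L1 : (2 ^ d - 1 < 2 ^ d)%N by rewrite subn1 prednK.
    rewrite add0r addn0 -subn1; have := @tile_top d v false q _ c L1 hc.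
    by rewrite muln0 add0n => ->.
  have b1 : (b.-1 < 2 ^ d)%N by lia.
  rewrite addr0; have := @tile_top d v true q _ c b1 hc; rewrite muln1 => <-.
  by congr (kap _ (tile _ _ _ _)); lia.
rewrite {1}expnSr mean_mul mean2.
rewrite (step false false) (step false true) (step true false) (step true true) /=; lra.
Qed.

(** A translation by 2^d - 1 is one supertile forward and one column back: the first column stays in
    its own supertile and gives [alpha], the others land in the next supertile and give [beta]. *)
Lemma nu_pred d m g : nu (d + m) g (2 ^ d - 1) = mean (2 ^ m) (fun i j =>
  alpha d (tile m g i j) (tile m g i j) + beta d (tile m g i j) (tile m g i.+1 j)).
Proof.
have L0 : (0 < 2 ^ d)%N by rewrite expn_gt0.
rewrite /nu expnD mean_mul; apply: eq_mean => i j _ _.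
rewrite -mean_alpha -mean_beta -meanD; apply: eq_mean => b c hb hc.
rewrite !(tile_split _ _ _ _ hb hc); case: eqP => [->|b0].
  have L1 : (2 ^ d - 1 < 2 ^ d)%N by rewrite subn1 prednK.
  by rewrite addr0 addn0 (tile_split _ _ _ _ L1 hc).
have b1 : (b.-1 < 2 ^ d)%N by lia.
rewrite add0r -(tile_split _ _ _ _ b1 hc); congr (kap _ (tile _ _ _ _)).
by rewrite mulnS; lia.
Qed.

Lemma tile_periodic1 M g i j : tile M g (2 ^ M + i) j = tile M g i j.
Proof. by have := tile_periodic M g i j 1 0; rewrite muln1 muln0 add0n. Qed.

Lemma nu_shift M g p q : (p <= q)%N ->
  mean (2 ^ M) (fun i j => kap (tile M g (i + p) j) (tile M g (i + q) j)) =
  nu M g (q - p).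
Proof.
move=> pq; rewrite -[RHS](mean_shiftn p).
  by apply: eq_mean => i j _ _; rewrite -addnA subnKC.
by move=> i j; rewrite -addnA !tile_periodic1.
Qed.

(** For the 2^M-periodic tile, the translations by 1 and by 2^M - 1 are inverse to each other and
    [kap] is symmetric, so this is [nu_pred] with a single supertile. *)
Lemma nu1 M g : nu M g 1 = alpha M g g + beta M g g.
Proof.
have L0 : (0 < 2 ^ M)%N by rewrite expn_gt0.
transitivity (nu M g (2 ^ M - 1)); last first.
  have := nu_pred M 0 g; rewrite addn0 => ->.
  by rewrite /mean /= !big_nat1 expr1n divr1.
rewrite -(@nu_shift M g 1 (2 ^ M)) //; apply: eq_mean => i j _ _.
by rewrite kapC (addnC i (2 ^ M)%N) tile_periodic1.
Qed.

Lemma nu1_near M g : `|nu M g 1 + 20^-1| <= 2^-1 ^+ M.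
Proof. by rewrite nu1 alpha_beta_diag_near. Qed.

(** Replacing [beta] by its limit leaves -1/15 times the correlation at distance 1, which is itself
    near -1/20; the 10 covers the errors 9 of [beta] and 3/4 of [alpha]. *)
Lemma nu_pred_near d m g :
  `|nu (d + m) g (2 ^ d - 1) - 300^-1| <= 10 * (3 / 4) ^+ d + 2^-1 ^+ m.
Proof.
have L0 : (0 < 2 ^ m)%N by rewrite expn_gt0.
have h2 : 2^-1 ^+ d <= (3 / 4) ^+ d :> R by rewrite lerXn2r ?nnegrE//; lra.
have h1 := nu1_near m g.
have E u v : - 15^-1 * kap u v - 10 * (3 / 4) ^+ d <= alpha d u u + beta d u v
    <= - 15^-1 * kap u v + 10 * (3 / 4) ^+ d.
  have := normr_alpha R d u u; have := beta_near d u v.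
  by rewrite !ler_norml; lra.
rewrite nu_pred.
have ub : mean (2 ^ m) (fun i j => alpha d (tile m g i j) (tile m g i j) +
    beta d (tile m g i j) (tile m g i.+1 j)) <= - 15^-1 * nu m g 1 + 10 * (3 / 4) ^+ d.
  rewrite -[X in _ + X](@mean_cst R (2 ^ m))// -meanZ -meanD.
  by apply: le_mean => i j _ _; rewrite addn1; case/andP: (E (tile m g i j) (tile m g i.+1 j)).
have lb : - 15^-1 * nu m g 1 - 10 * (3 / 4) ^+ d <= mean (2 ^ m) (fun i j =>
    alpha d (tile m g i j) (tile m g i j) + beta d (tile m g i j) (tile m g i.+1 j)).
  rewrite -[X in _ + X](@mean_cst R (2 ^ m))// -meanZ -meanD.
  by apply: le_mean => i j _ _; rewrite addn1; case/andP: (E (tile m g i j) (tile m g i.+1 j)).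
by move: h1 ub lb; rewrite !ler_norml; lra.
Qed.

(** The difference of the two powers is 2^(s+n) (2^(p-n) - 1), whose first factor is removed by
    [nu_mul]. *)
Lemma mean_kap_near s N L g n p : (n < N)%N -> (p < N)%N ->
  `|mean (2 ^ (s + N + L)) (fun i j => kap (tile (s + N + L) g (i + 2 ^ (s + n)) j)
      (tile (s + N + L) g (i + 2 ^ (s + p)) j)) - 300^-1| <=
  10 * (3 / 4) ^+ (n - p + (p - n)) + 2^-1 ^+ L.
Proof.
wlog np : n p / (n <= p)%N.
  move=> H hn hp; case: (leqP n p) => [np|/ltnW pn]; first exact: H.
  rewrite (addnC (n - p)%N); apply: le_trans (H p n pn hp hn).
  by under eq_mean do rewrite kapC.
move=> hn hp; rewrite nu_shift ?leq_exp2l ?leq_add2l//.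
have -> : (2 ^ (s + p) - 2 ^ (s + n) = 2 ^ (s + n) * (2 ^ (p - n) - 1))%N.
  by rewrite mulnBr muln1 -expnD; congr (2 ^ _ - _)%N; lia.
have -> : (s + N + L = (s + n) + ((p - n) + (N - p + L)))%N by lia.
rewrite nu_mul (eqP np) add0n; apply: (le_trans (nu_pred_near _ _ _)).
rewrite lerD2l ler_wiXn2l//; lia || lra.
Qed.

Lemma mean_kap0_near s N L g n : (n < N)%N ->
  `|mean (2 ^ (s + N + L)) (fun i j => kap (tile (s + N + L) g i j)
      (tile (s + N + L) g (i + 2 ^ (s + n)) j)) + 20^-1| <= 2^-1 ^+ L.
Proof.
move=> hn; rewrite -/(nu _ _ _) -[X in nu _ _ X]muln1.
have -> : (s + N + L = (s + n) + (N - n + L))%N by lia.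
rewrite nu_mul; apply: (le_trans (nu1_near _ _)).
by rewrite ler_wiXn2l//; lia || lra.
Qed.

(** Each new index adds a diagonal term 1 and two geometric sums bounded by 3. *)
Lemma sum_geometric_distance N :
  \sum_(0 <= n < N) \sum_(0 <= p < N) (3 / 4) ^+ (n - p + (p - n)) <= 7 * N%:R :> R.
Proof.
have T k : \sum_(0 <= n < k) (3 / 4) ^+ (k - n) <= 3 :> R.
  elim: k => [|k IH]; first by rewrite big_geq.
  rewrite big_nat_recr//= subSnn expr1.
  suff -> : \sum_(0 <= n < k) (3 / 4) ^+ (k.+1 - n) =
      3 / 4 * \sum_(0 <= n < k) (3 / 4) ^+ (k - n) :> R by lra.
  by rewrite mulr_sumr; apply: eq_big_nat => n /andP[_ hn]; rewrite -exprS subSn// ltnW.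
elim: N => [|N IH]; first by rewrite big_geq// mulr0.
rewrite big_nat_recr//=.
under eq_bigr do rewrite big_nat_recr//=.
rewrite big_split/= big_nat_recr//= subnn addn0 expr0.
have e1 : \sum_(0 <= n < N) (3 / 4) ^+ (n - N + (N - n)) =
    \sum_(0 <= n < N) (3 / 4) ^+ (N - n) :> R.
  by apply: eq_big_nat => n /andP[_ hn]; congr (_ ^+ _); lia.
have e2 : \sum_(0 <= n < N) (3 / 4) ^+ (N - n + (n - N)) =
    \sum_(0 <= n < N) (3 / 4) ^+ (N - n) :> R.
  by apply: eq_big_nat => n /andP[_ hn]; congr (_ ^+ _); lia.
by rewrite e1 e2 -[N.+1%:R]natr1; have := T N; lra.
Qed.

End CorrelationLimits.

(** * The polynomial annihilating the discrete and the continuous parts *)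

Section Operators.
Variable R : realFieldType.
Local Open Scope ring_scope.
Local Notation kap := (@kap R).
Implicit Types (f h : nat -> R).

(* In terms of the shift operator U acting on the sequence [f]: [opP] is
   P = (1/N) (U^(2^s) + ... + U^(2^(s+N-1))), [opP_c] is P + 1/15 and [opQ] is
   (P - 1)(P + 1/15), all evaluated at 0. The constant -1/15 is the limit
   of the normalized correlations at (2^n, 0). *)
Definition opP s N f : R := (\sum_(0 <= n < N) f (2 ^ (s + n))%N) / N%:R.
Definition opP_c s N f : R := opP s N f + 15^-1 * f 0%N.
Definition opQ s N f : R :=
  opP s N (fun k => opP_c s N (fun i => f (k + i)%N)) - opP_c s N f.

Lemma sum_kap u v : \sum_(a : letter) kap a u * kap a v = kap u v.
Proof.
rewrite /kap !big_ord_recl big_ord0.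
by elim/letter_ind: u; elim/letter_ind: v; rewrite /=; lra.
Qed.

(** The square of P + 1/15 is expanded; as [kap] is a projection, summing over [a] turns every
    product into a correlation. *)
Lemma sum_opP_c_kap_sqr s N (x : nat -> letter) :
  \sum_(a : letter) opP_c s N (fun k => kap a (x k)) ^+ 2 =
  (\sum_(0 <= n < N) \sum_(0 <= p < N)
     kap (x (2 ^ (s + n))%N) (x (2 ^ (s + p))%N)) / N%:R ^+ 2 +
  2 / 15 * ((\sum_(0 <= n < N) kap (x 0%N) (x (2 ^ (s + n))%N)) / N%:R) +
  225^-1 * kap (x 0%N) (x 0%N).
Proof.
pose S a := \sum_(0 <= n < N) kap a (x (2 ^ (s + n))%N).
transitivity (\sum_(a : letter) (S a * S a / N%:R ^+ 2 +
    2 / 15 * (kap a (x 0%N) * S a / N%:R) + 225^-1 * (kap a (x 0%N) * kap a (x 0%N)))).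
  apply: eq_bigr => a _; rewrite /opP_c /opP -/(S a) -exprVn.
  by move: N%:R^-1 => i; field.
rewrite 2!big_split/= -!mulr_suml -!mulr_sumr sum_kap -!mulr_suml; congr (_ / _ + _ * (_ / _) + _).
  transitivity (\sum_(a : letter) \sum_(0 <= n < N) \sum_(0 <= p < N)
      kap a (x (2 ^ (s + n))%N) * kap a (x (2 ^ (s + p))%N)).
    by apply: eq_bigr => a _; rewrite mulr_suml; apply: eq_bigr => n _; rewrite mulr_sumr.
  rewrite exchange_big/=; apply: eq_bigr => n _; rewrite exchange_big/=.
  by apply: eq_bigr => p _; rewrite sum_kap.
transitivity (\sum_(a : letter) \sum_(0 <= n < N) kap a (x 0%N) * kap a (x (2 ^ (s + n))%N)).
  by apply: eq_bigr => a _; rewrite mulr_sumr.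
by rewrite exchange_big/=; apply: eq_bigr => p _; rewrite sum_kap.
Qed.

(** The three terms of [sum_opP_c_kap_sqr] have limits 1/300, 2/15 * (-1/20) and 1/225 * 3/4, which
    cancel. The error 70/N is 10/N^2 times the bound 7N of [sum_geometric_distance]. *)
Lemma mean_opP_c_kap s N L g : (0 < N)%N ->
  mean (2 ^ (s + N + L)) (fun i j => \sum_(a : letter)
    opP_c s N (fun k => kap a (tile (s + N + L) g (i + k) j)) ^+ 2) <=
  70 / N%:R + 2 * 2^-1 ^+ L.
Proof.
move=> N0; set M := (s + N + L)%N.
have M0 : (0 < 2 ^ M)%N by rewrite expn_gt0.
have NR : 0 < N%:R :> R by rewrite ltr0n.
have Ni : 0 <= N%:R^-1 :> R by rewrite invr_ge0 ltW.
under eq_mean do rewrite sum_opP_c_kap_sqr addn0.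
rewrite !meanD !meanZ.
set A := mean _ _; set B := mean _ _; set C := mean _ _.
have hC : C = 3 / 4.
  rewrite -[RHS](@mean_cst R (2 ^ M))//; apply: eq_mean => i j _ _.
  exact: kapxx.
have hB : B <= - 20^-1 + 2^-1 ^+ L.
  rewrite {}/B; under eq_mean do rewrite mulrC.
  rewrite meanZ mean_sum mulrC ler_pdivrMr//.
  apply: (@le_trans _ _ (\sum_(0 <= n < N) (- 20^-1 + 2^-1 ^+ L))); last first.
    by rewrite sumr_const_nat subn0 mulr_natr.
  apply: ler_sum_nat => n /andP[_ hn]; have := mean_kap0_near R s L g hn.
  by rewrite ler_norml -/M; lra.
have hA : A <= 300^-1 + 2^-1 ^+ L + 70 / N%:R.
  rewrite {}/A; under eq_mean do rewrite mulrC.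
  rewrite meanZ mean_sum mulrC ler_pdivrMr ?exprn_gt0//.
  apply: (@le_trans _ _ (\sum_(0 <= n < N) \sum_(0 <= p < N)
      (300^-1 + 2^-1 ^+ L + 10 * (3 / 4) ^+ (n - p + (p - n))))).
    apply: ler_sum_nat => n /andP[_ hn]; rewrite mean_sum.
    apply: ler_sum_nat => p /andP[_ hp]; have := mean_kap_near R s L g hn hp.
    by rewrite ler_norml -/M; lra.
  have -> (K : R) (x : nat -> nat -> R) :
      \sum_(0 <= n < N) \sum_(0 <= p < N) (K + 10 * x n p) =
      N%:R ^+ 2 * K + 10 * \sum_(0 <= n < N) \sum_(0 <= p < N) x n p.
    transitivity (\sum_(0 <= n < N) (N%:R * K + 10 * \sum_(0 <= p < N) x n p)).
      by apply: eq_bigr => n _; rewrite big_split/= sumr_const_nat subn0 mulr_sumr mulr_natl.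
    by rewrite big_split/= sumr_const_nat subn0 -mulr_natl -mulr_sumr; ring.
  have e : 70 / N%:R * N%:R ^+ 2 = 70 * N%:R :> R.
    by rewrite expr2 mulrA divfK ?gt_eqF.
  move: (300^-1 + _) => K; rewrite [X in _ <= X]mulrDl e [X in _ <= X + _]mulrC.
  by have := sum_geometric_distance R N; lra.
have l0 : 0 <= 2^-1 ^+ L :> R by rewrite exprn_ge0.
by rewrite hC; lra.
Qed.

End Operators.

(** * Linearity, scaling and boundedness of the polynomial operators *)

Section OperatorBounds.
Variable R : realFieldType.
Local Open Scope ring_scope.
Implicit Types (f h : nat -> R).

Lemma eq_opP s N f h : (forall n, (n <= 2 ^ (s + N))%N -> f n = h n) ->
  opP s N f = opP s N h.
Proof.
move=> e; congr (_ / _); apply: eq_big_nat => n /andP[_ hn]; apply: e.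
by rewrite leq_exp2l// leq_add2l ltnW.
Qed.

Lemma le_opP s N f h : (forall n, f n <= h n) -> opP s N f <= opP s N h.
Proof.
by move=> e; rewrite ler_wpM2r ?invr_ge0//; apply: ler_sum => n _.
Qed.

Lemma opPD s N f h : opP s N (fun k => f k + h k) = opP s N f + opP s N h.
Proof. by rewrite /opP big_split mulrDl. Qed.

Lemma opPZ s N c f : opP s N (fun k => c * f k) = c * opP s N f.
Proof. by rewrite /opP -mulr_sumr mulrA. Qed.

Lemma opP_cst s N (c : R) : (0 < N)%N -> opP s N (fun=> c) = c.
Proof.
by move=> N0; rewrite /opP sumr_const_nat subn0 -[c *+ _]mulr_natr mulfK// pnatr_eq0 -lt0n.
Qed.

Lemma opP_sqr s N f : (0 < N)%N -> opP s N f ^+ 2 <= opP s N (fun k => f k ^+ 2).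
Proof.
move=> N0; rewrite -subr_ge0; set p := opP s N f.
have -> : opP s N (fun k => f k ^+ 2) - p ^+ 2 = opP s N (fun k => (f k - p) ^+ 2).
  transitivity (opP s N (fun k => f k ^+ 2 + (- 2 * p * f k + p ^+ 2))).
    by rewrite opPD opPD opPZ opP_cst// -/p; ring.
  by congr (opP _ _ _); apply/funext => k; ring.
by rewrite -[leLHS](@opP_cst s N)//; apply: le_opP => n; rewrite sqr_ge0.
Qed.

Lemma opP_scale m s N f : opP (m + s) N f = opP s N (fun k => f (2 ^ m * k)%N).
Proof. by congr (_ / _); apply: eq_bigr => n _; rewrite -addnA expnD. Qed.

Lemma opQ_scale m s N f : opQ (m + s) N f = opQ s N (fun k => f (2 ^ m * k)%N).
Proof.
rewrite /opQ /opP_c !opP_scale muln0; congr (opP _ _ _ - _).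
apply/funext => k; rewrite opP_scale !addn0; congr (opP _ _ _ + _).
by apply/funext => i; rewrite mulnDr.
Qed.

Lemma opQD s N f h : opQ s N (fun k => f k + h k) = opQ s N f + opQ s N h.
Proof.
rewrite /opQ /opP_c; under eq_fun do rewrite opPD mulrDr addrACA.
by rewrite !opPD; ring.
Qed.

Lemma opQZ s N c f : opQ s N (fun k => c * f k) = c * opQ s N f.
Proof.
rewrite /opQ /opP_c; under eq_fun do rewrite opPZ (mulrCA 15^-1) -mulrDr.
by rewrite !opPZ; ring.
Qed.

Lemma opQ_cst s N (c : R) : (0 < N)%N -> opQ s N (fun=> c) = 0.
Proof.
move=> N0; rewrite /opQ /opP_c; under eq_fun do rewrite opP_cst//.
by rewrite !opP_cst// subrr.
Qed.

Lemma eq_opQ s N f h : (forall n, (n <= 2 * 2 ^ (s + N))%N -> f n = h n) ->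
  opQ s N f = opQ s N h.
Proof.
move=> e; have e' n : (n <= 2 ^ (s + N))%N -> f n = h n by move=> ?; apply: e; lia.
rewrite /opQ /opP_c (eq_opP e') e'//; congr (_ - _); apply: eq_opP => n hn.
rewrite e ?addn0; last by lia.
by congr (_ + _); apply: eq_opP => i hi; apply: e; lia.
Qed.

(** A positive linear majorant: applied to the squares of the values it bounds the square of [opQ],
    by Jensen and (x + y)^2 <= 2x^2 + 2y^2 used twice. Its total weight is 16. *)
Definition opS s N f : R :=
  4 * opP s N (fun k => opP s N (fun i => f (k + i)%N) + f k) + 4 * (opP s N f + f 0%N).

Lemma opQ_sqr s N f : (0 < N)%N ->
  opQ s N f ^+ 2 <= opS s N (fun k => f k ^+ 2).
Proof.
move=> N0.
have sq (x y : R) : (x + y) ^+ 2 <= 2 * x ^+ 2 + 2 * y ^+ 2.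
  by have := sqr_ge0 (x - y); rewrite !expr2; lra.
have c_sqr h : opP_c s N h ^+ 2 <= 2 * (opP s N (fun k => h k ^+ 2) + h 0%N ^+ 2).
  have := sq (opP s N h) (15^-1 * h 0%N); have := opP_sqr s h N0.
  by rewrite /opP_c exprMn; have := sqr_ge0 (h 0%N); lra.
rewrite /opQ /opS; set p := fun k => opP_c s N _.
have h1 : opP s N p ^+ 2 <= 2 * opP s N (fun k =>
    opP s N (fun i => f (k + i)%N ^+ 2) + f k ^+ 2).
  rewrite -opPZ; apply: le_trans (opP_sqr s p N0) _; apply: le_opP => k.
  by rewrite /p; have := c_sqr (fun i => f (k + i)%N); rewrite addn0.
have := sq (opP s N p) (- opP_c s N f); rewrite sqrrN; have := c_sqr f; lra.
Qed.

Lemma opS_bounded s N f : (0 < N)%N -> (forall n, f n <= 1) -> opS s N f <= 16.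
Proof.
move=> N0 f1.
have P1 h : (forall n, h n <= 1) -> opP s N h <= 1.
  by move=> h1; rewrite -[leRHS](@opP_cst s N)//; apply: le_opP.
have := P1 f f1; have := f1 0%N.
suff : opP s N (fun k => opP s N (fun i => f (k + i)%N) + f k) <= 2.
  by rewrite /opS; lra.
rewrite -[leRHS](@opP_cst s N)//; apply: le_opP => n.
by have := P1 (fun i => f (n + i)%N) (fun i => f1 _); have := f1 n; lra.
Qed.

Lemma opQ_sqr_le16 s N f : (0 < N)%N -> (forall n, 0 <= f n <= 1) ->
  opQ s N f ^+ 2 <= 16.
Proof.
move=> N0 f1; apply: le_trans (opQ_sqr s f N0) _; apply: opS_bounded => // n.
by have /andP[? ?] := f1 n; rewrite expr_le1.
Qed.

Lemma mean_opP L s N (D : nat -> nat -> R) : (0 < N)%N ->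
  (forall i j, D (L + i)%N j = D i j) ->
  mean L (fun i j => opP s N (fun k => D (i + k)%N j)) = mean L D.
Proof.
move=> N0 per; rewrite /opP; under eq_mean do rewrite mulrC.
rewrite meanZ mean_sum mulrC; under eq_bigr do rewrite mean_shiftn//.
by rewrite sumr_const_nat subn0 -[_ *+ N in LHS]mulr_natr mulfK// pnatr_eq0 -lt0n.
Qed.

Lemma mean_opS L s N (D : nat -> nat -> R) : (0 < N)%N ->
  (forall i j, D (L + i)%N j = D i j) ->
  mean L (fun i j => opS s N (fun k => D (i + k)%N j)) = 16 * mean L D.
Proof.
move=> N0 per; rewrite /opS meanD !meanZ meanD mean_opP//.
under [X in _ + _ * (_ + X)]eq_mean do rewrite addn0.
under [X in _ * X + _]eq_mean do under eq_opP do under eq_opP do rewrite addnA.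
rewrite (@mean_opP L s N (fun i j => opP s N (fun k => D (i + k)%N j) + D i j))//.
  by rewrite meanD mean_opP//; ring.
by move=> i j; rewrite per; congr (_ + _); apply: eq_opP => n _; rewrite -addnA per.
Qed.

End OperatorBounds.

(** * Functions of a single letter *)

Section Cylinders.
Variable R : realFieldType.
Local Open Scope ring_scope.
Local Notation kap := (@kap R).

Lemma sum_letter (f : letter -> R) : \sum_(a : letter) f a = f a0 + f a1 + f a2 + f a3.
Proof.
rewrite !big_ord_recl big_ord0 addr0 !addrA.
by congr (f _ + f _ + f _ + f _); apply: val_inj.
Qed.

(** The function [phi] is its average over the letters, which Q kills, plus the combination of the
    [kap a] with coefficients [phi a]. The factor P - 1 is only bounded, at the cost of a 2; the
    other 4 is Cauchy-Schwarz over the letters. *)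
Lemma opQ_letter_sqr s N (phi : letter -> R) (x : nat -> letter) :
  (0 < N)%N -> (forall a, 0 <= phi a <= 1) ->
  opQ s N (fun k => phi (x k)) ^+ 2 <=
  8 * (opP s N (fun k => \sum_(a : letter)
         opP_c s N (fun i => kap a (x (k + i)%N)) ^+ 2) +
       \sum_(a : letter) opP_c s N (fun i => kap a (x i)) ^+ 2).
Proof.
move=> N0 phi1.
pose q a := opQ s N (fun k => kap a (x k)).
have -> : opQ s N (fun k => phi (x k)) =
    phi a0 * q a0 + (phi a1 * q a1 + (phi a2 * q a2 + phi a3 * q a3)).
  rewrite /q -!opQZ -!opQD.
  rewrite -[LHS]addr0 -(opQ_cst s (- 4^-1 * (phi a0 + phi a1 + phi a2 + phi a3)) N0).
  rewrite -opQD; congr opQ.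
  by apply/funext => k; move: (x k); elim/letter_ind; rewrite /kap /=; lra.
have q_sqr a : (phi a * q a) ^+ 2 <=
    2 * (opP s N (fun k => opP_c s N (fun i => kap a (x (k + i)%N)) ^+ 2) +
         opP_c s N (fun i => kap a (x i)) ^+ 2).
  apply: (@le_trans _ _ (q a ^+ 2)).
    rewrite exprMn ler_piMl ?sqr_ge0//.
    by have /andP[? ?] := phi1 a; rewrite expr_le1.
  rewrite /q /opQ; set p := fun k => opP_c s N _.
  have := opP_sqr s p N0; set y := opP_c s N _.
  have := sqr_ge0 (opP s N p + y); rewrite /p /= !expr2; lra.
have := q_sqr a0; have := q_sqr a1; have := q_sqr a2; have := q_sqr a3.
under [opP s N (fun k => \sum_a _)]eq_opP do rewrite sum_letter.
rewrite sum_letter !opPD.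
move: (phi a0 * _) (phi a1 * _) (phi a2 * _) (phi a3 * _) => y0 y1 y2 y3.
suff : (y0 + (y1 + (y2 + y3))) ^+ 2 <= 4 * (y0 ^+ 2 + y1 ^+ 2 + y2 ^+ 2 + y3 ^+ 2) by lra.
have := sqr_ge0 (y0 - y1); have := sqr_ge0 (y0 - y2); have := sqr_ge0 (y0 - y3).
have := sqr_ge0 (y1 - y2); have := sqr_ge0 (y1 - y3); have := sqr_ge0 (y2 - y3).
by rewrite !expr2; lra.
Qed.

Lemma mean_opQ_letter s N L g (phi : letter -> R) : (0 < N)%N ->
  (forall a, 0 <= phi a <= 1) ->
  mean (2 ^ (s + N + L)) (fun i j =>
    opQ s N (fun k => phi (tile (s + N + L) g (i + k) j)) ^+ 2) <=
  16 * (70 / N%:R + 2 * 2^-1 ^+ L).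
Proof.
move=> N0 phi1; set M := (s + N + L)%N.
pose V i j := \sum_(a : letter) opP_c s N (fun k => kap a (tile M g (i + k) j)) ^+ 2.
apply: (@le_trans _ _ (mean (2 ^ M) (fun i j =>
    8 * (opP s N (fun k => V (i + k)%N j) + V i j)))).
  apply: le_mean => i j _ _.
  apply: le_trans (opQ_letter_sqr s (fun k => tile M g (i + k) j) N0 phi1) _.
  rewrite /V ler_pM2l// lerD2r; apply: le_opP => n; apply: ler_sum => a _.
  by under [in leLHS]eq_fun do rewrite addnA.
rewrite meanZ meanD mean_opP//; first by have := mean_opP_c_kap R s L g N0; rewrite -/M -/V; lra.
move=> i j; apply: eq_bigr => a _; congr (_ ^+ 2); rewrite /opP_c; congr (_ + _ * _).
  by apply: eq_opP => n _; rewrite -addnA tile_periodic1.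
by rewrite -addnA tile_periodic1.
Qed.

Lemma mean_exchange K L (D : nat -> nat -> nat -> nat -> R) :
  mean K (fun i j => mean L (fun b c => D i j b c)) =
  mean L (fun b c => mean K (fun i j => D i j b c)).
Proof.
have E K' L' (D' : nat -> nat -> nat -> nat -> R) :
    mean K' (fun i j => mean L' (D' i j)) = (\sum_(0 <= i < K') \sum_(0 <= j < K')
      \sum_(0 <= b < L') \sum_(0 <= c < L') D' i j b c) / L'%:R ^+ 2 / K'%:R ^+ 2.
  by congr (_ / _); rewrite mulr_suml; apply: eq_bigr => i _; rewrite mulr_suml.
rewrite E (E L K (fun b c i j => D i j b c)) mulrAC; congr (_ / _ / _).
transitivity (\sum_(0 <= i < K) \sum_(0 <= b < L) \sum_(0 <= j < K) \sum_(0 <= c < L) D i j b c).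
  by apply: eq_bigr => i _; rewrite exchange_big.
rewrite exchange_big/=; apply: eq_bigr => b _.
transitivity (\sum_(0 <= i < K) \sum_(0 <= c < L) \sum_(0 <= j < K) D i j b c).
  by apply: eq_bigr => i _; rewrite exchange_big.
by rewrite exchange_big.
Qed.

Lemma mean_boundary r L : (0 < L)%N ->
  mean L (fun b c => ((L < b + r)%N)%:R + ((L < c + r)%N)%:R) <= 2 * r%:R / L%:R :> R.
Proof.
move=> L0; have LR : 0 < L%:R :> R by rewrite ltr0n.
have S : \sum_(0 <= b < L) ((L < b + r)%N)%:R <= r%:R :> R.
  rewrite -natr_sum ler_nat -big_mkcond /= sum1_count.
  rewrite -size_filter.
  apply: (@leq_trans (size (index_iota (L - r) L))); last by rewrite size_iota; lia.
  apply: uniq_leq_size; first by rewrite filter_uniq// iota_uniq.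
  by move=> b; rewrite mem_filter !mem_index_iota; lia.
rewrite meanD.
have e1 : mean L (fun b c => ((L < b + r)%N)%:R) <= r%:R / L%:R :> R.
  rewrite /mean; under eq_bigr do rewrite sumr_const_nat subn0 -[_ *+ L]mulr_natr.
  by rewrite -mulr_suml expr2 invfM mulrA mulfK ?gt_eqF// ler_pM2r ?invr_gt0.
have e2 : mean L (fun b c => ((L < c + r)%N)%:R) <= r%:R / L%:R :> R.
  rewrite /mean sumr_const_nat subn0 -[_ *+ L]mulr_natr.
  by rewrite expr2 invfM mulrA mulfK ?gt_eqF// ler_pM2r ?invr_gt0.
lra.
Qed.

End Cylinders.

(** * Local functions on a supertile *)

Section Windows.
Variable R : realFieldType.
Local Open Scope ring_scope.

Definition shiftw (w : nat -> nat -> letter) i j : nat -> nat -> letter :=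
  fun a b => w (i + a)%N (j + b)%N.

Definition local_fun r (F : (nat -> nat -> letter) -> R) : Prop :=
  (forall w w', (forall a b, (a < r)%N -> (b < r)%N -> w a b = w' a b) -> F w = F w')
  /\ forall w, 0 <= F w <= 1.

(* Away from the boundaries of the supertiles of level m, a local observable
   depends only on the type of the supertile and on the position in it;
   the shifts involved preserve this position. *)
Lemma mean_opQ_tile r F m s N L g : local_fun r F -> (0 < N)%N ->
  mean (2 ^ (m + (s + N + L))) (fun i j => opQ (m + s) N (fun k =>
    F (shiftw (tile (m + (s + N + L)) g) (i + k) j)) ^+ 2) <=
  32 * (70 / N%:R + 2 * 2^-1 ^+ L) + 64 * (r%:R / (2 ^ m)%:R).
Proof.
move=> [loc F1] N0; set M' := (s + N + L)%N.
have m0 : (0 < 2 ^ m)%N by rewrite expn_gt0.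
pose D i j := F (shiftw (tile (m + M') g) i j).
(* [H] reads the level m supertile around (i, j) as if it were repeated periodically; it differs
   from [D] only within r of the top or right boundary, which is where [Z] lives. *)
pose H i j := F (shiftw (tile m (tile M' g (i %/ 2 ^ m) (j %/ 2 ^ m))) i j).
pose Z i j := D i j - H i j.
have HE i j b c : (b < 2 ^ m)%N -> (c < 2 ^ m)%N ->
    H (2 ^ m * i + b)%N (2 ^ m * j + c)%N = F (shiftw (tile m (tile M' g i j)) b c).
  move=> hb hc; rewrite /H !(mulnC (2 ^ m)%N) !divnMDl// !divn_small// !addn0.
  congr F; apply/funext => a; apply/funext => a'.
  by rewrite /shiftw -!addnA !(mulnC _ (2 ^ m)%N) tile_periodic.
apply: (@le_trans _ _ (mean (2 ^ (m + M')) (fun i j =>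
    2 * opQ (m + s) N (fun k => H (i + k)%N j) ^+ 2 +
    2 * opS (m + s) N (fun k => Z (i + k)%N j ^+ 2)))).
  apply: le_mean => i j _ _; have := opQ_sqr (m + s) (fun k => Z (i + k)%N j) N0.
  have -> : opQ (m + s) N (fun k => F (shiftw (tile (m + M') g) (i + k) j)) =
      opQ (m + s) N (fun k => H (i + k)%N j) + opQ (m + s) N (fun k => Z (i + k)%N j).
    by rewrite -opQD; congr opQ; apply/funext => k; rewrite /Z addrC subrK.
  set x := opQ _ _ _; set y := opQ _ _ _; have := sqr_ge0 (x - y).
  by rewrite !expr2; lra.
rewrite meanD !meanZ.
have -> : 32 * (70 / N%:R + 2 * 2^-1 ^+ L) + 64 * (r%:R / (2 ^ m)%:R) =
    2 * (16 * (70 / N%:R + 2 * 2^-1 ^+ L)) + 2 * (16 * (2 * r%:R / (2 ^ m)%:R)) :> R.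
  by rewrite -!mulrA; ring.
apply: lerD; rewrite ler_pM2l//.
  (* Once the position (b, c) is fixed, [H] along the orbit is a function of the type of the level m
     supertile, and [opQ_scale] turns the translations into those of the sequence of types. *)
  rewrite expnD mean_mul mean_exchange -[leRHS](@mean_cst R (2 ^ m))//.
  apply: le_mean => b c hb hc.
  apply: le_trans (mean_opQ_letter s L g (phi := fun u => F (shiftw (tile m u) b c)) N0 _);
    last by move=> a; apply: F1.
  apply: le_mean => i j _ _; rewrite opQ_scale -/M' le_eqVlt; apply/orP; left; apply/eqP.
  congr (_ ^+ 2); congr opQ; apply/funext => k.
  by rewrite addnAC -mulnDr HE.
rewrite (mean_opS _ (D := fun i j => Z i j ^+ 2))//; last first.
  move=> i j; congr (_ ^+ 2); congr (_ - _).
    by congr F; apply/funext => a; apply/funext => b; rewrite /shiftw -addnA tile_periodic1.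
  rewrite /H expnD mulnC divnMDl// (mulnC (2 ^ M')%N); congr F.
  apply/funext => a; apply/funext => b; rewrite /shiftw -addnA -(expnD 2 m M').
  rewrite tile_periodic1 expnD.
  by have := tile_periodic m (tile M' g (i %/ 2 ^ m) (j %/ 2 ^ m)) (i + a) (j + b) (2 ^ M') 0;
    rewrite muln0 add0n => ->.
rewrite ler_pM2l// expnD mean_mul.
apply: (@le_trans _ _ (mean (2 ^ M') (fun _ _ => 2 * r%:R / (2 ^ m)%:R))); last first.
  by rewrite mean_cst// expn_gt0.
apply: le_mean => i j _ _; apply: le_trans (mean_boundary R r m0).
apply: le_mean => b c hb hc.
have Z1 : Z (2 ^ m * i + b)%N (2 ^ m * j + c)%N ^+ 2 <= 1.
  rewrite /Z /D /H; set w := shiftw _ _ _; set w' := shiftw _ _ _.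
  move: (F1 w) (F1 w'); move: (F w) (F w') => x y /andP[? ?] /andP[? ?].
  by rewrite expr2; nra.
case: (ltnP (2 ^ m) (b + r)) => hbr; first by apply: le_trans Z1 _; rewrite lerDl.
case: (ltnP (2 ^ m) (c + r)) => hcr; first by apply: le_trans Z1 _; rewrite lerDr.
rewrite /Z HE// /D (loc _ (shiftw (tile m (tile M' g i j)) b c)).
  by rewrite subrr expr0n addr0.
by move=> a a' ha ha'; rewrite /shiftw -!addnA tile_split//; lia.
Qed.

End Windows.

(** * Windows in arbitrary position *)

Section ArbitraryWindows.
Variable R : realFieldType.
Local Open Scope ring_scope.

Lemma sum_window L t (f : nat -> R) : (forall i, 0 <= f i) ->
  \sum_(0 <= i < L) f (t + i)%N <= \sum_(0 <= i < L * 2) f (L * (t %/ L) + i)%N.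
Proof.
move=> f0; case: (posnP L) => [->|L0]; first by rewrite !big_geq.
pose h i := f (L * (t %/ L) + i)%N; have a0 : (t %% L < L)%N by rewrite ltn_mod.
rewrite [leRHS](@big_cat_nat _ _ _ (t %% L)%N 0%N)//=; last lia.
rewrite [X in _ <= _ + X](@big_cat_nat _ _ _ (t %% L + L)%N)//=; [|lia|lia].
have -> : \sum_(0 <= i < L) f (t + i)%N = \sum_(t %% L <= i < t %% L + L) h i.
  rewrite -{1}[(t %% L)%N]add0n big_addn addKn; apply: eq_bigr => i _.
  by rewrite /h {1}(divn_eq t L) (mulnC _ L) -addnA (addnC i).
rewrite addrCA lerDl addr_ge0// sumr_ge0//.
Qed.

(** The window lies in a 2 by 2 block of aligned squares; 4 is the ratio of the two areas. *)
Lemma mean_window L t1 t2 (D : nat -> nat -> R) : (forall i j, 0 <= D i j) ->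
  mean L (fun i j => D (t1 + i)%N (t2 + j)%N) <=
  4 * mean (L * 2) (fun i j => D (L * (t1 %/ L) + i)%N (L * (t2 %/ L) + j)%N).
Proof.
move=> D0; rewrite /mean natrM exprMn; set S := (X in 4 * (X / _)).
have -> : 4 * (S / (L%:R ^+ 2 * 2%:R ^+ 2)) = S / L%:R ^+ 2 :> R.
  by rewrite invfM; move: (_ ^-1) => x; field.
rewrite ler_wpM2r ?invr_ge0 ?exprn_ge0//.
apply: le_trans (_ : _ <= \sum_(0 <= i < L) \sum_(0 <= j < L * 2)
  D (t1 + i)%N (L * (t2 %/ L) + j)%N) _.
  by apply: ler_sum => i _; apply: (sum_window L t2 (f := D (t1 + i)%N)).
rewrite exchange_big [leRHS]exchange_big /=; apply: ler_sum => j _.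
exact: (sum_window L t1 (f := fun i => D i _)).
Qed.


(** Each of the four supertiles is handled by [mean_opQ_tile] with s = N - m. The polynomial reaches
    2 * 2^(2N) columns to the right and [F] reads r further; where this leaves the supertile, the
    square is only bounded by 16, on a share of the positions that is small for large L. *)
Lemma mean_opQ_window r F m N L n g t1 t2 : local_fun r F -> (0 < N)%N -> (m <= N)%N ->
  mean (2 ^ (N + N + L)) (fun i j => opQ N N (fun k =>
    F (shiftw (tile (N + N + L + n) g) (t1 + i + k) (t2 + j))) ^+ 2) <=
  4 * (32 * (70 / N%:R + 2 * 2^-1 ^+ L) + 64 * (r%:R / (2 ^ m)%:R) +
       16 * (2 * (2 * 2 ^ (N + N) + r)%:R / (2 ^ (N + N + L))%:R)) :> R.
Proof.
move=> Fl N0 mN; move eM : (N + N + L)%N => M.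
move eK : (2 * 2 ^ (N + N) + r)%N => K.
have L0 : (0 < 2 ^ M)%N by rewrite expn_gt0.
have [loc F1] := Fl.
pose w := tile (M + n) g.
pose E i j := opQ N N (fun k => F (shiftw w (i + k) j)) ^+ 2.
apply: le_trans (mean_window (2 ^ M) t1 t2 (D := E) _) _.
  by move=> i j; rewrite sqr_ge0.
rewrite ler_pM2l// mean_mul.
set B := leRHS; rewrite -[B](@mean_cst R 2)//; apply: le_mean => p q _ _.
set u := tile n g (t1 %/ 2 ^ M + p) (t2 %/ 2 ^ M + q).
apply: (@le_trans _ _ (mean (2 ^ M) (fun b c =>
    opQ N N (fun k => F (shiftw (tile M u) (b + k) c)) ^+ 2 +
    16 * (((2 ^ M < b + K)%N)%:R + ((2 ^ M < c + K)%N)%:R)))).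
  apply: le_mean => b c hb hc; rewrite !addnA -!mulnDr.
  have O16 : E (2 ^ M * (t1 %/ 2 ^ M + p) + b)%N (2 ^ M * (t2 %/ 2 ^ M + q) + c)%N <= 16.
    by apply: opQ_sqr_le16 => // k; apply: F1.
  have sq0 := sqr_ge0 (opQ N N (fun k => F (shiftw (tile M u) (b + k) c))).
  case: (ltnP (2 ^ M) (b + K)) => hbK.
    by have := ler0n R (2 ^ M < c + K)%N; rewrite /=; lra.
  case: (ltnP (2 ^ M) (c + K)) => hcK; first by rewrite /=; lra.
  rewrite addr0 mulr0 addr0 /E (eq_opQ (h := fun k => F (shiftw (tile M u) (b + k) c)))//.
  move=> k hk; apply: loc => a a' ha ha'; rewrite /shiftw /w -!addnA.
  by rewrite tile_split//; lia.
rewrite meanD meanZ; apply: lerD; last by rewrite ler_pM2l// mean_boundary.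
have := mean_opQ_tile m (N - m) L u Fl N0.
by rewrite (_ : (m + (N - m + N + L) = M)%N) ?subnKC//; lia.
Qed.

End ArbitraryWindows.

(** * Cylinder sets and invariant measures *)

Section CylinderSets.
Local Open Scope classical_set_scope.

Definition cyl (l : seq ((int * int) * letter)) : set bconfig :=
  [set x | all (fun p => x p.1 == p.2) l].

Lemma open_cyl l : @open config (cyl l).
Proof.
elim: l => [|[k a] l IH].
  by rewrite (_ : cyl _ = setT); [exact: openT|apply/seteqP].
rewrite (_ : cyl _ = (proj k @^-1` [set a]) `&` cyl l); last first.
  apply/seteqP; split=> x; rewrite /cyl /=; first by move=> /andP[/eqP].
  by move=> [<- ->]; rewrite /proj eqxx.
apply: openI => //; apply: open_comp; last exact: discrete_open.
by move=> x _; exact: proj_continuous.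
Qed.

Lemma cyl_basis (U : set config) x : open U -> U x ->
  exists2 l, cyl l x & cyl l `<=` U.
Proof.
move=> oU Ux.
pose F : set_system config := filter_from [set l | cyl l x] cyl.
have FF : Filter F.
  apply: filter_from_filter; first by exists [::].
  move=> l l' lx lx'; exists (l ++ l'); first by rewrite /cyl /= all_cat lx.
  by move=> y; rewrite /cyl /= all_cat => /andP[].
have Fx : F --> x.
  apply/cvg_sup => i A /= [B [[C oC <-] Cx] BA].
  exists [:: (i, x i)]; first by rewrite /cyl /= eqxx.
  by move=> y; rewrite /cyl /= andbT => /eqP yi; apply: BA; rewrite /= yi.
by have /Fx [l lx lU] := open_nbhs_nbhs (conj oU Ux); exists l.
Qed.

(** There are only countably many cylinders, so each open set is a countable union of them; [h]
    enumerates them by [unpickle]. *)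
Lemma measurable_cylE : @measurable _ bconfig = <<s range cyl >>.
Proof.
apply/seteqP; split; apply: smallest_sub; try exact: smallest_sigma_algebra.
  move=> U oU; have -> : U = \bigcup_(l in [set l | cyl l `<=` U]) cyl l.
    apply/seteqP; split => [x Ux|x [l lU lx]]; last exact: lU.
    by have [l lx lU] := cyl_basis oU Ux; exists l.
  pose h (n : nat) : set bconfig := oapp cyl set0 (choice.unpickle n : option (seq ((int * int) * letter))).
  rewrite (_ : \bigcup_(_ in _) _ = \bigcup_n (if `[< h n `<=` U >] then h n else set0)).
    apply: sigma_algebra_bigcup => n; case: ifP => _; last exact: sigma_algebra0.
    rewrite /h; case: choice.unpickle => [l|] /=; last exact: sigma_algebra0.
    by apply: sub_gen_smallest; exists l.
  apply/seteqP; split => x.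
    move=> [l lU lx]; exists (choice.pickle l) => //=; rewrite /h choice.pickleK /=.
    by case: asboolP.
  move=> [n _]; case: asboolP => // nU; rewrite /h in nU *.
  by case: choice.unpickle nU => [l|] //= lU lx; exists l.
by move=> _ [l _ <-]; apply: sub_gen_smallest; exact: open_cyl.
Qed.

Lemma measurable_cyl l : measurable (cyl l).
Proof. by apply: sub_gen_smallest; exact: open_cyl. Qed.

Lemma cyl_setI : setI_closed (range cyl).
Proof.
move=> _ _ [l _ <-] [l' _ <-]; exists (l ++ l') => //.
apply/seteqP; split=> x; rewrite /cyl /= all_cat; first by move/andP.
by case=> -> ->.
Qed.

Lemma zshiftD k k' x : zshift k (zshift k' x) = zshift (k' + k)%R x.
Proof. by apply/funext => j; rewrite /zshift -addrA (addrC k). Qed.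

Lemma measurable_zshift k : measurable_fun setT (zshift k).
Proof.
apply: (@measurability _ _ bconfig bconfig setT (zshift k) (range cyl) measurable_cylE) => _ [_ [l _ <-] <-]; rewrite setTI.
rewrite (_ : _ @^-1` _ = cyl [seq ((p.1 + k)%R, p.2) | p <- l]); first exact: measurable_cyl.
by apply/seteqP; split=> x; rewrite /cyl /= all_map.
Qed.

(** Finite windows, iterates, letters and translations are all countable, so the subshift is a
    countable intersection of countable unions of the sets [W], each a cylinder or empty. *)
Lemma measurable_subshift S : measurable (subshift S).
Proof.
pose W n g (t : int * int) (F : {fset int * int}) : set bconfig :=
  [set x | forall k, k \in F -> iter n (subst_ext S) (single g) (k + t)%R = Some (x k)].
have mW n g t F : measurable (W n g t F).
  pose l := pmap (fun k => omap (pair k) (iter n (subst_ext S) (single g) (k + t)%R)) F.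
  case: (pselect (forall k, k \in F -> iter n (subst_ext S) (single g) (k + t)%R)) => hF.
    rewrite (_ : W n g t F = cyl l); first exact: measurable_cyl.
    apply/seteqP; split => x.
      move=> Wx; apply/allP => -[k a]; rewrite mem_pmap => /mapP[k' k'F].
      by rewrite Wx//= => -[-> ->].
    move=> /allP lx k kF; have := hF k kF; case E : (iter _ _ _ _) => [a|]// _.
    congr Some; apply/esym/eqP; apply: (lx (k, a)).
    by rewrite mem_pmap; apply/mapP; exists k => //; rewrite E.
  rewrite (_ : W n g t F = set0)//; apply/seteqP; split => // x Wx; apply: hF => k kF.
  by rewrite Wx.
rewrite (_ : subshift S = ~` \bigcup_F ~` \bigcup_n \bigcup_g \bigcup_t W n g t F).
  apply: measurableC; apply: countable_bigcupT_measurable => [|F]; first exact: countableP.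
  apply: measurableC.
  apply: countable_bigcupT_measurable => [|n]; first exact: countableP.
  apply: countable_bigcupT_measurable => [|g]; first exact: countableP.
  by apply: countable_bigcupT_measurable => [|t]; first exact: countableP; exact: mW.
apply/seteqP; split => x.
  by move=> Sx [F _]; apply; have [n [g [t h]]] := Sx F; exists n => //; exists g => //; exists t.
move=> h F; apply: contrapT => hF; apply: h; exists F => // -[n _ [g _ [t _ Wx]]].
by apply: hF; exists n, g, t.
Qed.

End CylinderSets.

(** * From supertiles to points of the subshift *)

Section SubshiftWindows.
Variable R : realFieldType.
Local Open Scope ring_scope.

Lemma iter_subst_tile n g j a :
  iter n (subst_ext table) (single g) j = Some a ->
  exists i1 i2 : nat, [/\ j = (i1%:Z, i2%:Z), (i1 < 2 ^ n)%N, (i2 < 2 ^ n)%N &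
    a = tile n g i1 i2].
Proof.
have half_int (z : int) (i : nat) : (z %/ 2)%Z = i%:Z ->
    exists i' : nat, [/\ z = i'%:Z, i'./2 = i & odd i' = ((z %% 2)%Z == 1)].
  move=> zi; have z0 := @modz_ge0 z 2 isT; have z2 := @ltz_pmod z 2 isT.
  have ze := divz_eq z 2; rewrite zi in ze.
  case r : (z %% 2)%Z z0 z2 ze => [[|[|r']]|r'] // _ _ ze.
    by exists (2 * i)%N; split; lia.
  by exists (2 * i).+1; split; lia.
elim: n j a => [|n IH] j a /=.
  rewrite /single; case: eqP => // -> [<-]; exists 0%N, 0%N; split => //.
move: (iter n _ _) IH => w IH; rewrite /subst_ext.
case E : (w _) => [a'|] //= [<-].
have [i1 [i2 [[h1 h2] l1 l2 ->]]] := IH _ _ E.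
have [k1 [e1 f1 g1]] := half_int _ _ h1; have [k2 [e2 f2 g2]] := half_int _ _ h2.
exists k1, k2; split; [by rewrite -e1 -e2 -surjective_pairing|rewrite expnS; lia|rewrite expnS; lia|].
by rewrite -g1 -g2 f1 f2.
Qed.

(** Only the first quadrant is read, so that positions are natural numbers as in [tile]; invariance
    of the measure brings every cylinder there. *)
Definition natpart (x : bconfig) : nat -> nat -> letter := fun a b => x (a%:Z, b%:Z).

Lemma mean_opQ_subshift r (F : (nat -> nat -> letter) -> R) m N L (x : bconfig) :
  local_fun r F -> (0 < N)%N -> (m <= N)%N -> subshift table x ->
  mean (2 ^ (N + N + L)) (fun i j => opQ N N (fun k =>
    F (natpart (zshift ((i + k)%N%:Z, j%:Z) x))) ^+ 2) <=
  4 * (32 * (70 / N%:R + 2 * 2^-1 ^+ L) + 64 * (r%:R / (2 ^ m)%:R) +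
       16 * (2 * (2 * 2 ^ (N + N) + r)%:R / (2 ^ (N + N + L))%:R)) :> R.
Proof.
move=> Fl N0 mN Xx.
(* The side exceeds every coordinate i + k + a that is read, where k is at most 2 * 2^(2N). *)
pose S := (2 ^ (N + N + L) + 2 * 2 ^ (N + N) + r).+1.
pose B := seq_fset tt [seq (a%:Z, b%:Z) | a <- iota 0 S, b <- iota 0 S].
have [n [g [t tx]]] := Xx B.
have {}tx (a b : nat) : (a < S)%N -> (b < S)%N -> exists i1 i2 : nat,
    [/\ a%:Z + t.1 = i1%:Z, b%:Z + t.2 = i2%:Z, (i1 < 2 ^ n)%N &
    x (a%:Z, b%:Z) = tile n g i1 i2].
  move=> aS bS; have abB : (a%:Z, b%:Z) \in B.
    by rewrite seq_fsetE; apply: allpairs_f; rewrite mem_iota.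
  by have [i1 [i2 [[? ?] ? ? ?]]] := iter_subst_tile (tx _ abB); exists i1, i2.
have [t1 [t2 [e1 e2 _ _]]] := tx 0%N 0%N isT isT.
have {}tx (a b : nat) : (a < S)%N -> (b < S)%N ->
    (t1 + a < 2 ^ n)%N /\ x (a%:Z, b%:Z) = tile n g (t1 + a) (t2 + b).
  move=> aS bS; have [i1 [i2 [h1 h2 l1 ->]]] := tx a b aS bS.
  have -> : i1 = (t1 + a)%N by lia.
  have -> : i2 = (t2 + b)%N by lia.
  by split => //; lia.
(* A block wider than 2^(2N+L) fits in an n-th iterate only if n >= 2N + L, which allows the
   supertile to be split. *)
have Mn : (N + N + L <= n)%N.
  have MS : (2 ^ (N + N + L) < S)%N by rewrite /S; lia.
  have [h _] := tx _ 0%N MS isT.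
  by rewrite -(@leq_exp2l 2)//; lia.
rewrite -(subnKC Mn) in tx.
apply: le_trans (mean_opQ_window L (n - (N + N + L)) g t1 t2 Fl N0 mN).
apply: le_mean => i j hi hj; rewrite le_eqVlt; apply/orP; left; apply/eqP.
congr (_ ^+ 2); apply: eq_opQ => k hk; apply: (proj1 Fl) => a b ha hb.
rewrite /natpart /zshift /shiftw /=.
have iS : (i + k + a < S)%N by rewrite /S; lia.
have jS : (j + b < S)%N by rewrite /S; lia.
have [_ e] := tx _ _ iS jS.
rewrite !addnA in e *; rewrite -e; by congr (x (_, _)); rewrite /=; lia.
Qed.

End SubshiftWindows.

(** * Integrals under an invariant measure *)

Section InvariantMeasure.
Local Open Scope classical_set_scope.
Local Open Scope ring_scope.
Variables (R : realType) (mu : probability bconfig R).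
Hypothesis mu_inv : forall (k : int * int) (B : set bconfig), measurable B ->
  mu (zshift k @^-1` B) = mu B.
Implicit Types (f h : bconfig -> R).

Lemma integral_zshift k (g : bconfig -> \bar R) : measurable_fun setT g ->
  (forall x, (0 <= g x)%E) ->
  (\int[mu]_x g (zshift k x) = \int[mu]_x g x)%E.
Proof.
move=> mg g0.
rewrite -[LHS](ge0_integral_pushforward (measurable_zshift k) mu measurableT mg)//.
apply: eq_measure_integral; first exact: measurable_zshift.
by move=> ? A mA _; exact: mu_inv.
Qed.

Lemma ge0_integral_scaled_sum d (T : measurableType d) (m : {measure set T -> \bar R})
    (n : nat) (c v : R) (h : nat -> T -> R) :
  (forall i, measurable_fun setT (h i)) -> (forall i x, 0 <= h i x) -> 0 <= c ->
  (forall i, (\int[m]_x (h i x)%:E = v%:E)%E) ->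
  (\int[m]_x ((\sum_(0 <= i < n) h i x) * c)%:E = (n%:R * v * c)%:E)%E.
Proof.
move=> mh h0 c0 hv.
under eq_integral do rewrite mulrC EFinM -sumEFin.
rewrite ge0_integralZl_EFin//; last 2 first.
- by move=> x _; apply: sume_ge0 => i _; rewrite lee_fin.
- by apply: emeasurable_sum => i; apply/measurable_EFinP.
rewrite ge0_integral_sum//; last 2 first.
- by move=> i; apply/measurable_EFinP.
- by move=> i x _; rewrite lee_fin.
rewrite (eq_bigr (fun=> v%:E))// sumEFin sumr_const_nat subn0 -EFinM.
by rewrite -[v *+ _]mulr_natl mulrC.
Qed.

Lemma measurable_opP d (T : measurableType d) s N (h : nat -> T -> R) :
  (forall i, measurable_fun setT (h i)) ->
  measurable_fun setT (fun x => opP s N (fun k => h k x)).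
Proof.
move=> mh; apply: measurable_funM => //; apply: measurable_sum => i; exact: mh.
Qed.

Lemma integral_opP d (T : measurableType d) (m : {measure set T -> \bar R})
    s N (v : R) (h : nat -> T -> R) : (0 < N)%N ->
  (forall i, measurable_fun setT (h i)) -> (forall i x, 0 <= h i x) ->
  (forall i, (\int[m]_x (h i x)%:E = v%:E)%E) ->
  (\int[m]_x (opP s N (fun k => h k x))%:E = v%:E)%E.
Proof.
move=> N0 mh h0 hv.
rewrite (@ge0_integral_scaled_sum _ _ _ N N%:R^-1 v (fun n => h (2 ^ (s + n))%N))//.
by rewrite mulrC mulKf// pnatr_eq0 -lt0n.
Qed.

Lemma measurable_opQ d (T : measurableType d) s N (h : nat -> T -> R) :
  (forall i, measurable_fun setT (h i)) ->
  measurable_fun setT (fun x => opQ s N (fun k => h k x)).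
Proof.
move=> mh; have mc (h' : nat -> T -> R) : (forall i, measurable_fun setT (h' i)) ->
    measurable_fun setT (fun x => opP_c s N (fun k => h' k x)).
  move=> mh'; apply: measurable_funD; first exact: measurable_opP.
  by apply: measurable_funM.
apply: measurable_funB; last exact: mc.
by apply: measurable_opP => i; apply: mc => k.
Qed.

Definition shift_orbit f (x : bconfig) (k : nat) : R := f (zshift (k%:Z, 0) x).

Lemma measurable_shift_orbit f k : measurable_fun setT f ->
  measurable_fun setT (fun x => shift_orbit f x k).
Proof. by move=> mf; apply: measurableT_comp => //; exact: measurable_zshift. Qed.

Definition energy N f : \bar R := (\int[mu]_x ((opQ N N (shift_orbit f x)) ^+ 2)%:E)%E.

Lemma measurable_opQ_orbit N f : measurable_fun setT f ->
  measurable_fun setT (fun x => opQ N N (shift_orbit f x)).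
Proof.
by move=> mf; apply: (measurable_opQ N N (h := fun k x => shift_orbit f x k)) => k; exact: measurable_shift_orbit.
Qed.

(** Invariance gives all shifts of f^2 the same integral, so the integral of the majorant [opS] is
    16 times it. This bound, uniform in N, permits approximation in L^2. *)
Lemma energy_le N f : (0 < N)%N -> measurable_fun setT f ->
  (energy N f <= 16%:E * \int[mu]_x (f x ^+ 2)%:E)%E.
Proof.
move=> N0 mf; have mf2 : measurable_fun setT (fun x => f x ^+ 2) by exact: measurable_funX.
have I0 : (0 <= \int[mu]_x (f x ^+ 2)%:E)%E.
  by apply: integral_ge0 => x _; rewrite lee_fin sqr_ge0.
case E : (\int[mu]_x (f x ^+ 2)%:E)%E I0 => [v| |]// _; last first.
  by rewrite mulry gtr0_sg// mul1e leey.
have mo k : measurable_fun setT (fun x => shift_orbit f x k ^+ 2).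
  by apply: measurable_funX; exact: measurable_shift_orbit.
have ho k : (\int[mu]_x (shift_orbit f x k ^+ 2)%:E = v%:E)%E.
  rewrite -E -(integral_zshift (k%:Z, 0) (g := fun x => (f x ^+ 2)%:E))//.
    exact/measurable_EFinP.
  by move=> x; rewrite lee_fin sqr_ge0.
have mP k : measurable_fun setT (fun x => opP N N (fun i => shift_orbit f x (k + i)%N ^+ 2)).
  by apply: (measurable_opP N N (h := fun i x => shift_orbit f x (k + i)%N ^+ 2)).
have hP k : (\int[mu]_x (opP N N (fun i => shift_orbit f x (k + i)%N ^+ 2))%:E = v%:E)%E.
  by apply: (integral_opP _ _ (h := fun i x => shift_orbit f x (k + i)%N ^+ 2)) => // i x; rewrite sqr_ge0.
have pos k x : 0 <= opP N N (fun i => shift_orbit f x (k + i)%N ^+ 2).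
  by rewrite -[leLHS](@opP_cst R N N)//; apply: le_opP => i; rewrite sqr_ge0.
have add (p q : bconfig -> R) (a b : R) : measurable_fun setT p -> measurable_fun setT q ->
    (forall x, 0 <= p x) -> (forall x, 0 <= q x) ->
    (\int[mu]_x (p x)%:E = a%:E)%E -> (\int[mu]_x (q x)%:E = b%:E)%E ->
    (\int[mu]_x (p x + q x)%:E = (a + b)%:E)%E.
  move=> mp mq p0 q0 ha hb; under eq_integral do rewrite EFinD.
  by rewrite ge0_integralD ?ha ?hb//; do ?[by move=> x _; rewrite lee_fin]; exact/measurable_EFinP.
have mul4 (p : bconfig -> R) (a : R) : measurable_fun setT p -> (forall x, 0 <= p x) ->
    (\int[mu]_x (p x)%:E = a%:E)%E -> (\int[mu]_x (4 * p x)%:E = (4 * a)%:E)%E.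
  move=> mp p0 ha; under eq_integral do rewrite EFinM.
  rewrite ge0_integralZl_EFin ?ha//; first by move=> x _; rewrite lee_fin.
  exact/measurable_EFinP.
apply: (@le_trans _ _ (\int[mu]_x (opS N N (fun k => shift_orbit f x k ^+ 2))%:E)%E).
  apply: ge0_le_integral => //.
  - by move=> x _; rewrite lee_fin sqr_ge0.
  - by apply/measurable_EFinP/measurable_funX; exact: measurable_opQ_orbit.
  - apply/measurable_EFinP; apply: measurable_funD; apply: measurable_funM => //.
      apply: (measurable_opP N N (h := fun k x =>
        opP N N (fun i => shift_orbit f x (k + i)%N ^+ 2) + shift_orbit f x k ^+ 2)) => i.
      by apply: measurable_funD.
    by apply: measurable_funD => //; exact: (mP 0%N).
  - by move=> x _; rewrite lee_fin; apply: opQ_sqr.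
have inner k : (\int[mu]_x (opP N N (fun i => shift_orbit f x (k + i)%N ^+ 2) + shift_orbit f x k ^+ 2)%:E
    = (v + v)%:E)%E.
  by apply: add => // x; rewrite sqr_ge0.
rewrite /opS (add _ _ (4 * (v + v)) (4 * (v + v))).
- by rewrite -EFinM lee_fin; lra.
- apply: measurable_funM => //.
  apply: (measurable_opP N N (h := fun k x =>
    opP N N (fun i => shift_orbit f x (k + i)%N ^+ 2) + shift_orbit f x k ^+ 2)) => i.
  by apply: measurable_funD.
- by apply: measurable_funM => //; apply: measurable_funD => //; exact: (mP 0%N).
- move=> x; rewrite mulr_ge0// -[leLHS](@opP_cst R N N)//; apply: le_opP => i.
  by rewrite addr_ge0// sqr_ge0.
- by move=> x; rewrite mulr_ge0// addr_ge0 ?sqr_ge0//; exact: (pos 0%N).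
- apply: mul4.
  + apply: (measurable_opP N N (h := fun k x =>
      opP N N (fun i => shift_orbit f x (k + i)%N ^+ 2) + shift_orbit f x k ^+ 2)) => i.
    by apply: measurable_funD.
  + move=> x; rewrite -[leLHS](@opP_cst R N N)//; apply: le_opP => i.
    by rewrite addr_ge0// sqr_ge0.
  apply: (integral_opP _ _ (h := fun k x =>
      opP N N (fun i => shift_orbit f x (k + i)%N ^+ 2) + shift_orbit f x k ^+ 2)) => // i.
    by apply: measurable_funD.
  by move=> x; rewrite addr_ge0// sqr_ge0.
- apply: mul4 => [|x|].
  + by apply: measurable_funD => //; exact: (mP 0%N).
  + by rewrite addr_ge0 ?sqr_ge0//; exact: (pos 0%N).
  + exact: (inner 0%N).
Qed.

End InvariantMeasure.

(** * The closed subspace on which the polynomials tend to 0 *)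

Section Vanishing.
Local Open Scope classical_set_scope.
Local Open Scope ring_scope.
Variables (R : realType) (mu : probability bconfig R).
Hypothesis mu_inv : forall (k : int * int) (B : set bconfig), measurable B ->
  mu (zshift k @^-1` B) = mu B.
Implicit Types (f h : bconfig -> R).

Definition vanishing f : Prop := measurable_fun setT f /\
  forall e : R, 0 < e -> exists N0, forall N, (N0 <= N)%N -> (energy mu N f <= e%:E)%E.

Lemma measurable_sqr_opQ N f : measurable_fun setT f ->
  measurable_fun setT (fun x => ((opQ N N (shift_orbit f x)) ^+ 2)%:E).
Proof.
by move=> mf; apply/measurable_EFinP/measurable_funX; exact: measurable_opQ_orbit.
Qed.

Lemma energyZ N (c : R) f : measurable_fun setT f ->
  energy mu N (fun x => c * f x) = ((c ^+ 2)%:E * energy mu N f)%E.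
Proof.
move=> mf; rewrite /energy -ge0_integralZl_EFin ?sqr_ge0//.
- by apply: eq_integral => x _; rewrite -EFinM -exprMn -opQZ.
- by move=> x _; rewrite lee_fin sqr_ge0.
- exact: measurable_sqr_opQ.
Qed.

Lemma energyD N f h : measurable_fun setT f -> measurable_fun setT h ->
  (energy mu N (fun x => f x + h x)%R <= 2%:E * energy mu N f + 2%:E * energy mu N h)%E.
Proof.
move=> mf mh; rewrite /energy -!ge0_integralZl_EFin//; do ?[exact: measurable_sqr_opQ];
  do ?[by move=> x _; rewrite lee_fin sqr_ge0].
rewrite -ge0_integralD//; do ?[by move=> x _; rewrite mule_ge0// lee_fin sqr_ge0];
  do ?[by apply: emeasurable_funM => //; exact: measurable_sqr_opQ].
apply: ge0_le_integral => //.
- by move=> x _; rewrite lee_fin sqr_ge0.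
- by apply: measurable_sqr_opQ; exact: measurable_funD.
- by apply: emeasurable_funD; apply: emeasurable_funM => //; exact: measurable_sqr_opQ.
move=> x _; rewrite lee_fin.
have -> : shift_orbit (fun x => f x + h x) x = fun k => shift_orbit f x k + shift_orbit h x k by [].
rewrite opQD; set a := opQ _ _ _; set b := opQ _ _ _.
by have := sqr_ge0 (a - b); rewrite !expr2; lra.
Qed.

Lemma vanishing_cst (c : R) : vanishing (fun=> c).
Proof.
split => // e e0; exists 1%N => N N0.
rewrite /energy (_ : (fun _ => _) = cst 0%E) ?integral0 ?lee_fin ?ltW//.
by apply/funext => x; rewrite /= (opQ_cst _ _ N0) expr0n.
Qed.

Lemma vanishingZ (c : R) f : vanishing f -> vanishing (fun x => c * f x).
Proof.
move=> [mf vf]; split; first exact: measurable_funM.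
move=> e e0; have c0 : 0 < c ^+ 2 + 1 by rewrite ltr_wpDl// sqr_ge0.
have [N0 hN] := vf (e / (c ^+ 2 + 1)) (divr_gt0 e0 c0).
exists N0 => N /hN le; rewrite energyZ//.
apply: (@le_trans _ _ ((c ^+ 2)%:E * (e / (c ^+ 2 + 1))%:E)%E).
  by rewrite lee_wpmul2l// lee_fin sqr_ge0.
rewrite -EFinM lee_fin mulrCA; apply: ler_piMr; first exact: ltW.
by rewrite ler_pdivrMr// mul1r lerDl.
Qed.

Lemma vanishingD f h : vanishing f -> vanishing h -> vanishing (fun x => f x + h x).
Proof.
move=> [mf vf] [mh vh]; split; first exact: measurable_funD.
move=> e e0; have e4 : 0 < e / 4 by rewrite divr_gt0.
have [N1 h1] := vf _ e4; have [N2 h2] := vh _ e4.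
exists (maxn N1 N2) => N; rewrite geq_max => /andP[/h1 {}h1 /h2 {}h2].
apply: le_trans (energyD N mf mh) _.
apply: (@le_trans _ _ (2%:E * (e / 4)%:E + 2%:E * (e / 4)%:E)%E).
  by apply: leeD; rewrite lee_wpmul2l.
by rewrite -!EFinM -EFinD lee_fin; lra.
Qed.

Lemma vanishing_approx f : measurable_fun setT f ->
  (forall e : R, 0 < e -> exists2 h, vanishing h &
     (\int[mu]_x ((f x - h x) ^+ 2)%:E <= e%:E)%E) ->
  vanishing f.
Proof.
move=> mf H; split => // e e0.
(* The shares are chosen so that 2 * 16 * (e/64) + 2 * (e/4) = e. *)
have e1 : 0 < e / 4 by rewrite divr_gt0.
have e2 : 0 < e / 64 by rewrite divr_gt0.
have [h [mh vh] fh] := H _ e2; have [N0 hN] := vh _ e1.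
exists (maxn N0 1) => N; rewrite geq_max => /andP[/hN {}hN N1].
have mfh : measurable_fun setT (fun x => f x - h x) by exact: measurable_funB.
have -> : f = (fun x => (f x - h x) + h x) by apply/funext => x; rewrite subrK.
apply: le_trans (energyD N mfh mh) _.
apply: (@le_trans _ _ (2%:E * (16%:E * (e / 64)%:E) + 2%:E * (e / 4)%:E)%E).
  apply: leeD; rewrite lee_wpmul2l//; apply: le_trans (energy_le mu_inv N1 mfh) _.
  by rewrite lee_wpmul2l.
by rewrite -!EFinM -EFinD lee_fin; lra.
Qed.

End Vanishing.

(** * Vanishing on cylinders *)

Section VanishingCylinders.
Local Open Scope classical_set_scope.
Local Open Scope ring_scope.
Variables (R : realType) (mu : probability bconfig R).
Hypothesis mu_inv : forall (k : int * int) (B : set bconfig), measurable B ->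
  mu (zshift k @^-1` B) = mu B.
Hypothesis mu_full : mu (subshift table) = 1%E.

Lemma measurable_mean d (T : measurableType d) L (g : nat -> nat -> T -> R) :
  (forall i j, measurable_fun setT (g i j)) ->
  measurable_fun setT (fun x => mean L (fun i j => g i j x)).
Proof.
move=> mg; apply: measurable_funM => //; apply: measurable_sum => i.
by apply: measurable_sum.
Qed.

(** By invariance [g] and its window means have the same integral, and these means are at most B on
    a set of full measure. The bound 16 makes the integral finite. *)
Lemma integral_le_mean L (g : bconfig -> R) (B : R) : (0 < L)%N ->
  measurable_fun setT g -> (forall x, 0 <= g x <= 16) ->
  (forall x, subshift table x -> mean L (fun i j => g (zshift (i%:Z, j%:Z) x)) <= B) ->
  (\int[mu]_x (g x)%:E <= B%:E)%E.
Proof.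
move=> L0 mg g16 gB.
have icst (c : R) : (\int[mu]_x c%:E = c%:E)%E.
  transitivity (c%:E * 1)%E; last by rewrite mule1.
  rewrite [LHS](integral_cst mu measurableT); congr (_ * _)%E.
  exact: probability_setT.
(* A point of the subshift yields 0 <= B. *)
have [x0 Xx0] : exists x, subshift table x.
  apply: contrapT => nX; move: mu_full; rewrite (_ : subshift table = set0).
    by rewrite measure0 => /eqP; rewrite eq_sym onee_eq0.
  by apply/seteqP; split => // x Xx; apply: nX; exists x.
have g0 x : 0 <= g x by case/andP: (g16 x).
have mgs i j : measurable_fun setT (fun x => g (zshift (i%:Z, j%:Z) x)).
  by apply: measurableT_comp => //; exact: measurable_zshift.
have mgE : measurable_fun setT (fun x => (g x)%:E) by exact/measurable_EFinP.
have [v hv] : exists v, (\int[mu]_x (g x)%:E = v%:E)%E.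
  have : (\int[mu]_x (g x)%:E <= 16%:E)%E.
    apply: (@le_trans _ _ (\int[mu]_x 16%:E)%E).
      by apply: ge0_le_integral => // x _; rewrite lee_fin; case/andP: (g16 x).
    by rewrite icst.
  have : (0 <= \int[mu]_x (g x)%:E)%E by apply: integral_ge0 => x _; rewrite lee_fin.
  by case: (\int[mu]_x _)%E => [v| |]// _ _; exists v.
have hvs i j : (\int[mu]_x (g (zshift (i%:Z, j%:Z) x))%:E = v%:E)%E.
  by rewrite -hv -(integral_zshift mu_inv (i%:Z, j%:Z) (g := fun x => (g x)%:E)).
have -> : (\int[mu]_x (g x)%:E =
    \int[mu]_x (mean L (fun i j => g (zshift (i%:Z, j%:Z) x)))%:E)%E.
  rewrite (ge0_integral_scaled_sum (v := L%:R * v) (c := (L%:R ^+ 2)^-1)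
    (h := fun i x => \sum_(0 <= j < L) g (zshift (i%:Z, j%:Z) x)) L).
  - by rewrite hv; congr EFin; field; rewrite pnatr_eq0 -lt0n.
  - by move=> i; apply: measurable_sum => j; exact: mgs.
  - by move=> i x; apply: sumr_ge0.
  - by [].
  - move=> i; have := ge0_integral_scaled_sum (c := 1) L (mgs i) _ ler01 (hvs i).
    rewrite mulr1 => <- //; by under [RHS]eq_integral do rewrite mulr1.
rewrite -icst.
apply: ae_ge0_le_integral => //.
- by move=> x _; rewrite lee_fin mean_ge0.
- by apply/measurable_EFinP; apply: measurable_mean.
- by move=> x _; rewrite lee_fin (le_trans _ (gB _ Xx0))// mean_ge0.
- exists (~` subshift table); split.
  + by apply: measurableC; exact: measurable_subshift.
  + have := probability_setC mu (measurable_subshift table).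
    by rewrite mu_full subee.
  + by move=> x /=; apply: contra_not => Xx _; rewrite lee_fin; exact: gB.
Qed.

Lemma eventually_small (c e : R) : 0 <= c -> 0 < e -> exists2 n0, (0 < n0)%N &
  forall n, (n0 <= n)%N -> c / n%:R <= e /\ c * 2^-1 ^+ n <= e.
Proof.
move=> c0 e0; exists (Num.Def.archi_bound (c / e)).+1 => // n hn.
have n0 : 0 < n%:R :> R by rewrite ltr0n (leq_trans _ hn).
have ce : c / e <= n%:R.
  apply: le_trans (ltW (archi_boundP (divr_ge0 c0 (ltW e0)))) _.
  by rewrite ler_nat (leq_trans _ hn).
have le1 : c / n%:R <= e by rewrite ler_pdivrMr// mulrC -ler_pdivrMr.
split => //; apply: le_trans le1; rewrite ler_wpM2l// exprVn.
by rewrite lef_pV2 ?posrE ?exprn_gt0// -natrX ler_nat ltnW// ltn_expl.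
Qed.

Lemma energy_local r (F : (nat -> nat -> letter) -> R) m N L :
  local_fun r F -> (0 < N)%N -> (m <= N)%N ->
  measurable_fun setT (fun x => F (natpart x)) ->
  (energy mu N (fun x => F (natpart x)) <=
   (4 * (32 * (70 / N%:R + 2 * 2^-1 ^+ L) + 64 * (r%:R / (2 ^ m)%:R) +
     16 * (2 * (2 * 2 ^ (N + N) + r)%:R / (2 ^ (N + N + L))%:R)))%:E)%E.
Proof.
move=> Fl N0 mN mF; apply: (@integral_le_mean (2 ^ (N + N + L))).
- by rewrite expn_gt0.
- by apply: measurable_funX; exact: measurable_opQ_orbit.
- by move=> x; rewrite sqr_ge0/= opQ_sqr_le16// => k; exact: (proj2 Fl).
move=> x Xx; apply: le_trans (mean_opQ_subshift L Fl N0 mN Xx).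
rewrite le_eqVlt; apply/orP; left; apply/eqP; apply: eq_mean => i j _ _.
congr (_ ^+ 2); congr opQ; apply/funext => k; rewrite /shift_orbit zshiftD.
by congr (F (natpart (zshift (_, _) x))); rewrite /= ?add0r ?addr0 ?PoszD//= addrC.
Qed.

Lemma vanishing_local r (F : (nat -> nat -> letter) -> R) : local_fun r F ->
  measurable_fun setT (fun x => F (natpart x)) ->
  vanishing mu (fun x => F (natpart x)).
Proof.
move=> Fl mF; split => // e e0.
have e8 : 0 < e / 8 by rewrite divr_gt0.
(* The order of choices matters: m, then N, then L depending on N. The constants are 4*64, 4*32*70,
   4*32*2 and 4*16*2 from [energy_local], and each term is at most e/8. *)
have [m _ hm] := eventually_small (c := 256 * r%:R) (mulr_ge0 (ler0n _ _) (ler0n _ _)) e8.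
have [N1 N10 hN1] := eventually_small (c := 8960) (ler0n _ _) e8.
exists (maxn m N1) => N; rewrite geq_max => /andP[mN hN].
have N0 : (0 < N)%N by rewrite (leq_trans N10).
have [L1 _ hL1] := eventually_small (c := 256) (ler0n _ _) e8.
have [L2 _ hL2] := eventually_small (c := 128 * (2 * 2 ^ (N + N) + r)%:R)
  (mulr_ge0 (ler0n _ _) (ler0n _ _)) e8.
pose L := maxn L1 L2.
apply: le_trans (energy_local L Fl N0 mN mF) _; rewrite lee_fin.
have [_ {}hm] := hm m (leqnn m); have [{}hN1 _] := hN1 N hN.
have [_ {}hL1] := hL1 L (leq_maxl _ _); have [_ {}hL2] := hL2 L (leq_maxr _ _).
have h1 : r%:R / (2 ^ m)%:R = r%:R * 2^-1 ^+ m :> R by rewrite natrX exprVn.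
have h2 : (2 * 2 ^ (N + N) + r)%:R / (2 ^ (N + N + L))%:R <=
    (2 * 2 ^ (N + N) + r)%:R * 2^-1 ^+ L :> R.
  rewrite ler_wpM2l// natrX exprVn lef_pV2 ?posrE ?exprn_gt0//.
  by rewrite ler_weXn2l ?ler1n// leq_addl.
move: h2; rewrite h1 -[2 * _%:R / _]mulrA; set X := _ / (2 ^ _)%:R => h2.
by lra.
Qed.

(** Translating by (r, r) moves the finitely many coordinates into the first quadrant; [energy] is
    unchanged because Q commutes with the shifts, which preserve mu. *)
Lemma vanishing_cyl l : vanishing mu (\1_(cyl l) : bconfig -> R).
Proof.
have [r hr] : exists r : nat, forall p, p \in l ->
    (- r%:Z <= p.1.1) && (p.1.1 <= r%:Z) && ((- r%:Z <= p.1.2) && (p.1.2 <= r%:Z)).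
  elim: l => [|p l [r hr]]; first by exists 0%N.
  exists (r + `|p.1.1| + `|p.1.2|)%N => q; rewrite inE => /orP[/eqP ->|/hr].
    by case: p => -[p1 p2] a /=; lia.
  by case: p q => -[p1 p2] a [[q1 q2] b] /=; lia.
pose F (w : nat -> nat -> letter) : R :=
  (all (fun p : (int * int) * letter =>
    w (absz (p.1.1 + r%:Z)) (absz (p.1.2 + r%:Z)) == p.2) l)%:R.
have Fl : local_fun (2 * r).+1 F.
  split => [w w' ww'|w]; last by rewrite /F; case: all; rewrite ?lexx ler01.
  rewrite /F; congr (nat_of_bool _)%:R; apply: eq_in_all => -[[p1 p2] a] /hr /= rp.
  by rewrite ww'//; lia.
have E x : \1_(cyl l) x = F (natpart (zshift (- r%:Z, - r%:Z) x)) :> R.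
  rewrite indicE /F; congr (nat_of_bool _)%:R.
  transitivity (all (fun p => x p.1 == p.2) l).
    by apply/idP/idP; rewrite inE.
  apply: eq_in_all => -[[k1 k2] a] /hr /= rp; rewrite /natpart /zshift /=.
  by congr (x _ == _); congr (_, _); rewrite /= in rp *; lia.
have mF : measurable_fun setT (fun x => F (natpart x)).
  rewrite (_ : (fun x => _) = (\1_(cyl l) : bconfig -> R) \o zshift (r%:Z, r%:Z)).
    apply: measurableT_comp; last exact: measurable_zshift.
    by apply/measurable_indicP; exact: measurable_cyl.
  apply/funext => x; rewrite /= E zshiftD; congr (F (natpart _)).
  by apply/funext => -[j1 j2]; rewrite /zshift; congr (x (_, _)); rewrite /=; lia.
have [_ vF] := vanishing_local Fl mF.
split; first by apply/measurable_indicP; exact: measurable_cyl.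
move=> e /vF[N0 hN]; exists N0 => N /hN; apply: le_trans; rewrite le_eqVlt; apply/orP; left.
apply/eqP; rewrite /energy.
rewrite -(integral_zshift mu_inv (- r%:Z, - r%:Z)
  (g := fun x => (opQ N N (shift_orbit (fun x => F (natpart x)) x) ^+ 2)%:E)).
- apply: eq_integral => x _; congr (_ ^+ 2)%:E; congr opQ; apply/funext => k.
  rewrite /shift_orbit E !zshiftD; congr (F (natpart (zshift _ x))).
  by rewrite addrC.
- by apply: measurable_sqr_opQ.
- by move=> y; rewrite lee_fin sqr_ge0.
Qed.

End VanishingCylinders.

(** * From cylinders to all of L^2 *)

Section VanishingL2.
Import HBNNSimple.
Local Open Scope classical_set_scope.
Local Open Scope ring_scope.
Variables (R : realType) (mu : probability bconfig R).
Hypothesis mu_inv : forall (k : int * int) (B : set bconfig), measurable B ->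
  mu (zshift k @^-1` B) = mu B.
Hypothesis mu_full : mu (subshift table) = 1%E.

Lemma vanishing_lim (f : bconfig -> R) (h : (bconfig -> R)^nat) (g : bconfig -> R) :
  measurable_fun setT f -> (forall n, vanishing mu (h n)) ->
  (forall x, h n x @[n --> \oo] --> f x) ->
  mu.-integrable setT (EFin \o g) -> (forall n x, (f x - h n x) ^+ 2 <= g x) ->
  vanishing mu f.
Proof.
move=> mf vh hf ig hg; apply: (vanishing_approx mu_inv) => // e e0.
have mh n : measurable_fun setT (h n) by have [] := vh n.
have mz n : measurable_fun setT (fun x => ((f x - h n x) ^+ 2)%:E).
  by apply/measurable_EFinP/measurable_funX; exact: measurable_funB.
have cz x : ((f x - h n x) ^+ 2)%:E @[n --> \oo] --> 0%E.
  rewrite (_ : 0%E = ((f x - f x) ^+ 2)%:E); last by rewrite subrr expr0n.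
  apply: cvg_EFin; first by near=> n.
  rewrite /= expr2; under eq_fun do rewrite expr2.
  by apply: cvgM; apply: cvgB => //; exact: cvg_cst.
have cae : \forall x \ae mu, setT x -> ((f x - h n x) ^+ 2)%:E @[n --> \oo] --> 0%E.
  by apply: aeW => x _; exact: cz.
have gae : \forall x \ae mu, forall n, setT x ->
    (`|((f x - h n x) ^+ 2)%:E| <= (EFin \o g) x)%E.
  by apply: aeW => x n _ /=; rewrite lee_fin ger0_norm ?sqr_ge0.
have [_ _] := dominated_convergence measurableT mz (measurable_cst _) cae ig gae.
rewrite integral0 => cv.
have /cv [n _ hn] : nbhs (0%E : \bar R) [set y | (y < e%:E)%E].
  by apply: open_ereal_lt'; rewrite lte_fin.
by exists (h n) => //; apply/ltW/(hn n) => /=.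
Unshelve. all: by end_near. Qed.

Lemma vanishing_sum (I : Type) (s : seq I) (h : I -> bconfig -> R) :
  (forall i, vanishing mu (h i)) -> vanishing mu (fun x => \sum_(i <- s) h i x).
Proof.
move=> vh; elim: s => [|i s IH].
  by under eq_fun do rewrite big_nil; exact: vanishing_cst.
by under eq_fun do rewrite big_cons; exact: vanishingD.
Qed.

(** Dynkin's argument: cylinders are stable under intersection, and vanishing indicators are stable
    under complements and, by dominated convergence, under countable disjoint unions. *)
Lemma vanishing_indic (B : set bconfig) : measurable B ->
  vanishing mu (\1_B : bconfig -> R).
Proof.
move=> mB; have sB : <<s range cyl >> B by rewrite -measurable_cylE.
move: B sB {mB}.
apply: (dynkin_induction (P := fun B => vanishing mu (\1_B : bconfig -> R)) measurable_cylE).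
- exact: cyl_setI.
- rewrite (_ : \1_setT = fun=> 1); first exact: vanishing_cst.
  by apply/funext => x; rewrite indicT.
- by move=> _ [l _ <-]; exact: vanishing_cyl.
- move=> S mS vS; rewrite (_ : \1_(~` S) = fun x => 1 + -1 * \1_S x).
    by apply: vanishingD; [exact: vanishing_cst|exact: vanishingZ].
  apply/funext => x; rewrite !indicE in_setC.
  by case: (x \in S) => /=; rewrite ?mulr1 ?mulr0 ?subrr ?addr0.
- move=> F mF tF vF.
  have sumF x k n : F k x -> \sum_(0 <= i < n) \1_(F i) x = (k < n)%N%:R :> R.
    move=> Fk; have F0 i : i != k -> \1_(F i) x = 0 :> R.
      move=> /eqP ik; rewrite indicE memNset// => Fi; apply: ik.
      by apply: (tF i k) => //; exists x.
    elim: n => [|n IH]; first by rewrite big_geq.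
    rewrite big_nat_recr//= {}IH ltnS; case: (ltngtP k n) => kn.
    - by rewrite F0 ?addr0// gtn_eqF.
    - by rewrite F0 ?addr0// ltn_eqF.
    - by rewrite -kn indicE mem_set//= add0r.
  have sumN x n : ~ (\bigcup_k F k) x -> \sum_(0 <= i < n) \1_(F i) x = 0 :> R.
    move=> nU; rewrite big1// => i _; rewrite indicE memNset// => Fi.
    by apply: nU; exists i.
  apply: (@vanishing_lim _ (fun n x => \sum_(0 <= i < n) \1_(F i) x) (fun=> 1)).
  + by apply/measurable_indicP; exact: bigcupT_measurable.
  + by move=> n; exact: vanishing_sum.
  + move=> x; apply: cvg_near_cst.
    case: (pselect ((\bigcup_k F k) x)) => [[k _ Fk]|nU].
      exists k.+1 => // n /= kn; rewrite (sumF _ _ _ Fk) kn indicE mem_set//.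
      by exists k.
    by near=> n; rewrite sumN// indicE memNset.
  + exact: finite_measure_integrable_cst.
  + move=> n x; case: (pselect ((\bigcup_k F k) x)) => [Ux|nU].
      have [k _ Fk] := Ux; rewrite (sumF _ _ _ Fk) indicE mem_set//.
      by case: (k < n)%N; rewrite /= ?subrr ?subr0 ?expr1n// expr0n.
    by rewrite sumN// indicE memNset// subrr expr0n.
Unshelve. all: by end_near. Qed.

Lemma vanishing_ge0 (f : bconfig -> R) : measurable_fun setT f -> (forall x, 0 <= f x) ->
  (\int[mu]_x (f x ^+ 2)%:E < +oo)%E -> vanishing mu f.
Proof.
move=> mf f0 f2.
have mfE : measurable_fun setT (EFin \o f) by exact/measurable_EFinP.
have f0E x : setT x -> (0 <= (EFin \o f) x)%E by move=> _; rewrite lee_fin.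
have H := (@vanishing_lim f (fun n => nnsfun_approx measurableT mfE n : bconfig -> R) (fun x => f x ^+ 2)). apply: H.
- by [].
- move=> n; set h := nnsfun_approx _ _ _.
  rewrite (_ : (h : bconfig -> R) = fun x => \sum_(y <- fset_set (range h)) y * \1_(h @^-1` [set y]) x).
    apply: vanishing_sum => y; apply: vanishingZ; apply: vanishing_indic.
    by rewrite -[X in measurable X]setTI; exact: measurable_funP.
  by apply/funext => x; rewrite fimfunE fsbig_finite.
- move=> x; have /fine_cvg := cvg_nnsfun_approx measurableT mfE f0E (x := x) I.
  exact.
- apply/integrableP; split; first by apply/measurable_EFinP; exact: measurable_funX.
  rewrite (eq_integral (fun x => (f x ^+ 2)%:E))// => x _ /=.
  by rewrite ger0_norm// sqr_ge0.
- move=> n x; have := le_approx n f0E (x := x) I.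
  rewrite -(nnsfun_approxE measurableT mfE) lee_fin.
  have : 0 <= nnsfun_approx measurableT mfE n x by [].
  move: (nnsfun_approx _ _ _ x) (f0 x) => y y0 y1 y2; rewrite !expr2; nra.
Qed.

Lemma vanishing_L2 (f : bconfig -> R) : measurable_fun setT f ->
  (\int[mu]_x (f x ^+ 2)%:E < +oo)%E -> vanishing mu f.
Proof.
move=> mf f2.
have le2 (g : bconfig -> R) : measurable_fun setT g -> (forall x, g x ^+ 2 <= f x ^+ 2) ->
    (\int[mu]_x (g x ^+ 2)%:E < +oo)%E.
  move=> mg gf; apply: le_lt_trans f2; apply: ge0_le_integral => //.
  - by move=> x _; rewrite lee_fin sqr_ge0.
  - by apply/measurable_EFinP; exact: measurable_funX.
  - by apply/measurable_EFinP; exact: measurable_funX.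
  - by move=> x _; rewrite lee_fin.
rewrite (_ : f = fun x => Num.max (f x) 0 + -1 * Num.max (- f x) 0).
  apply: vanishingD; last apply: vanishingZ.
  - apply: vanishing_ge0; last apply: le2.
    + exact: measurable_maxr.
    + by move=> x; rewrite le_max lexx orbT.
    + exact: measurable_maxr.
    + by move=> x; case: (leP (f x) 0) => _; rewrite ?expr0n /= ?sqr_ge0.
  - apply: vanishing_ge0; last apply: le2.
    + by apply: measurable_maxr => //; exact: measurableT_comp.
    + by move=> x; rewrite le_max lexx orbT.
    + by apply: measurable_maxr => //; exact: measurableT_comp.
    + by move=> x; case: (leP (- f x) 0) => _; rewrite ?sqrrN ?expr0n /= ?sqr_ge0.
apply/funext => x; rewrite mulN1r; case: (leP (f x) 0) => h; case: leP => h'; lra.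
Qed.

End VanishingL2.

(** * Transfer to the spectral measure *)

Section Isometry.
Local Open Scope classical_set_scope.
Local Open Scope ring_scope.
Variable R : realType.

Lemma integral_lincomb d (T : measurableType d) (m : {measure set T -> \bar R})
    (D : set T) (I : Type) (s : seq I) (c : I -> R) (h : I -> T -> R) (r : I -> R) :
  measurable D -> (forall i, m.-integrable D (EFin \o h i)) ->
  (forall i, (\int[m]_(x in D) (h i x)%:E = (r i)%:E)%E) ->
  (\int[m]_(x in D) (\sum_(i <- s) c i * h i x)%:E = (\sum_(i <- s) c i * r i)%:E)%E.
Proof.
move=> mD ih hr.
have ic i : m.-integrable D (EFin \o (fun x => c i * h i x)).
  rewrite (_ : _ \o _ = fun x => ((c i)%:E * (EFin \o h i) x)%E); first exact: integrableZl.
  by apply/funext => x; rewrite /= EFinM.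
elim: s => [|i s IH].
  by under eq_integral do rewrite big_nil; rewrite integral0 big_nil.
under eq_integral do rewrite big_cons EFinD.
rewrite (integralD_EFin mD (f1 := fun x => c i * h i x)
  (f2 := fun x => \sum_(j <- s) c j * h j x))//; last first.
  rewrite (_ : EFin \o _ = fun x => (\sum_(j <- s) (c j * h j x)%:E)%E).
    by apply: integrable_sum => // j _; exact: ic.
  by apply/funext => x; rewrite /= sumEFin.
rewrite IH big_cons EFinD; congr (_ + _)%E.
under eq_integral do rewrite /= EFinM.
by rewrite (integralZl mD (ih i)) EFinM -hr.
Qed.

Definition dist (p q : nat) : nat := (p - q) + (q - p).

Definition cosn (k : nat) (t : R) : R := cos (k%:R * (2 * pi * t)).
Definition sinn (k : nat) (t : R) : R := sin (k%:R * (2 * pi * t)).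

Lemma cosn_dist p q t :
  cosn p t * cosn q t + sinn p t * sinn q t = cosn (dist p q) t.
Proof.
wlog qp : p q / (q <= p)%N.
  move=> H; case: (leqP q p) => [/H//|/ltnW/H].
  by rewrite /dist addnC => <-; rewrite mulrC [sinn p t * _]mulrC.
rewrite /dist (eqP qp) addn0 /cosn /sinn -cosB.
by rewrite natrB// mulrBl.
Qed.

Definition pairs (l : seq (R * nat)) := [seq (p, q) | p <- l, q <- l].

Lemma sqr_pairs (l : seq (R * nat)) (a b : nat -> R) :
  (\sum_(p <- l) p.1 * a p.2) ^+ 2 + (\sum_(p <- l) p.1 * b p.2) ^+ 2 =
  \sum_(z <- pairs l) (z.1.1 * z.2.1) * (a z.1.2 * a z.2.2 + b z.1.2 * b z.2.2).
Proof.
rewrite /pairs big_allpairs_dep /= !expr2 !mulr_suml -big_split /=.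
apply: eq_bigr => p _; rewrite !mulr_sumr -big_split /=; apply: eq_bigr => q _.
ring.
Qed.

Lemma opP_comb s N : exists l : seq (R * nat), forall f : nat -> R,
  opP s N f = \sum_(p <- l) p.1 * f p.2.
Proof.
exists [seq (N%:R^-1, (2 ^ (s + n))%N) | n <- index_iota 0 N] => f.
by rewrite big_map /opP mulr_suml; apply: eq_bigr => n _; rewrite mulrC.
Qed.

(** One list of coefficients and exponents serves both for orbits and for the trigonometric
    sequences, so that the two sides of the isometry expand in the same way. *)
Lemma opQ_comb s N : exists l : seq (R * nat), forall f : nat -> R,
  opQ s N f = \sum_(p <- l) p.1 * f p.2.
Proof.
have [l hl] := opP_comb s N.
exists ([seq (p.1 * q.1, (p.2 + q.2)%N) | p <- l, q <- l] ++
  [seq ((15^-1 - 1) * p.1, p.2) | p <- l] ++ [:: (- 15^-1, 0%N)]) => f.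
rewrite !big_cat /= big_allpairs_dep big_map big_seq1 /= /opQ /opP_c !hl.
have -> : \sum_(p <- l) p.1 * (opP s N (fun i => f (p.2 + i)%N) + 15^-1 * f (p.2 + 0)%N) =
    \sum_(p <- l) \sum_(q <- l) p.1 * q.1 * f (p.2 + q.2)%N +
    15^-1 * \sum_(p <- l) p.1 * f p.2.
  rewrite mulr_sumr -big_split /=; apply: eq_bigr => p _; rewrite hl mulrDr mulr_sumr addn0.
  by congr (_ + _); [apply: eq_bigr => q _; rewrite mulrA|ring].
have -> : \sum_(p <- l) (15^-1 - 1) * p.1 * f p.2 = (15^-1 - 1) * \sum_(p <- l) p.1 * f p.2.
  by rewrite mulr_sumr; apply: eq_bigr => p _; rewrite mulrA.
ring.
Qed.

Lemma measurable_cosn k : measurable_fun setT (cosn k).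
Proof.
apply: measurableT_comp; first exact: continuous_measurable_fun (@continuous_cos R).
by apply: measurable_funM => //; apply: measurable_funM.
Qed.

Lemma measurable_sinn k : measurable_fun setT (sinn k).
Proof.
apply: measurableT_comp; first exact: continuous_measurable_fun (@continuous_sin R).
by apply: measurable_funM => //; apply: measurable_funM.
Qed.

Lemma cosn_bounded (A : Type) (u : A -> R) (B : set A) k :
  [bounded cosn k (u x) | x in B].
Proof.
exists 1; split => // y y1 x _ /=; apply: le_trans (ltW y1).
by rewrite ler_norml cos_geN1 cos_le1.
Qed.

End Isometry.

Section SpectralIsometry.
Local Open Scope classical_set_scope.
Local Open Scope ring_scope.
Local Open Scope complex_scope.
Variables (R : realType) (mu : probability bconfig R).
Hypothesis mu_inv : forall (k : int * int) (B : set bconfig), measurable B ->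
  mu (zshift k @^-1` B) = mu B.
Implicit Types (f g : bconfig -> R).

Lemma circle_ptX (t : R) n : circle_pt t ^+ n = cosn n t +i* sinn n t.
Proof.
elim: n => [|n IH]; first by rewrite /cosn /sinn !mul0r cos0 sin0.
rewrite exprSr IH /circle_pt /cosn /sinn; move: (2 * pi * t) => y.
rewrite -(natr1 n) mulrDl mul1r cosD sinD; apply/eqP.
by rewrite eq_complex /= eqxx [X in _ == X]addrC eqxx.
Qed.

Lemma normc_sqr (z : R[i]) : Normc.normc z ^+ 2 = complex.Re z ^+ 2 + complex.Im z ^+ 2.
Proof. by case: z => a b /=; rewrite sqr_sqrtr// addr_ge0// sqr_ge0. Qed.

Definition square_integrable f : Prop :=
  measurable_fun setT f /\ (\int[mu]_x (f x ^+ 2)%:E < +oo)%E.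

Lemma L2_square_integrable (F : bconfig -> R[i]) : L2 mu F ->
  square_integrable (fun x => complex.Re (F x)) /\
  square_integrable (fun x => complex.Im (F x)).
Proof.
move=> [mf mg F2].
have E : (\int[mu]_x (Normc.normc (F x) ^+ 2)%:E =
    \int[mu]_x (complex.Re (F x) ^+ 2 + complex.Im (F x) ^+ 2)%:E)%E.
  by apply: eq_integral => x _; rewrite normc_sqr.
have mE : measurable_fun setT (fun x => (complex.Re (F x) ^+ 2 + complex.Im (F x) ^+ 2)%:E).
  by apply/measurable_EFinP; apply: measurable_funD; exact: measurable_funX.
rewrite E in F2; split; split => //; apply: le_lt_trans F2; apply: ge0_le_integral => //.
- by move=> x _; rewrite lee_fin sqr_ge0.
- by apply/measurable_EFinP; exact: measurable_funX.
- by move=> x _; rewrite lee_fin lerDl sqr_ge0.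
- by move=> x _; rewrite lee_fin sqr_ge0.
- by apply/measurable_EFinP; exact: measurable_funX.
- by move=> x _; rewrite lee_fin lerDr sqr_ge0.
Qed.

Lemma integrable_shift_mul f p q : square_integrable f ->
  mu.-integrable setT (EFin \o (fun x => shift_orbit f x p * shift_orbit f x q)).
Proof.
move=> [mf f2].
have mfs k : measurable_fun setT (fun x => shift_orbit f x k) by exact: measurable_shift_orbit.
have ifs k : mu.-integrable setT (EFin \o (fun x => shift_orbit f x k ^+ 2)).
  apply/integrableP; split; first by apply/measurable_EFinP; exact: measurable_funX.
  under eq_integral do rewrite /= ger0_norm ?sqr_ge0//.
  rewrite (integral_zshift mu_inv (k%:Z, 0) (g := fun x => (f x ^+ 2)%:E))//.
    by apply/measurable_EFinP; exact: measurable_funX.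
  by move=> x; rewrite lee_fin sqr_ge0.
apply: (@le_integrable _ _ _ mu setT measurableT _
  (EFin \o (fun x => shift_orbit f x p ^+ 2 + shift_orbit f x q ^+ 2))).
- by apply/measurable_EFinP; apply: measurable_funM.
- move=> x _ /=; rewrite lee_fin [leRHS]ger0_norm ?addr_ge0 ?sqr_ge0// normrM.
  rewrite -[_ ^+ 2 in leRHS]real_normK ?num_real// -[X in _ <= _ + X]real_normK ?num_real//.
  have := sqr_ge0 (`|shift_orbit f x p| - `|shift_orbit f x q|).
  have := normr_ge0 (shift_orbit f x p); have := normr_ge0 (shift_orbit f x q).
  by move: `|_| `|_| => a b; rewrite !expr2; nra.
- rewrite (_ : _ \o _ = fun x => ((shift_orbit f x p ^+ 2)%:E + (shift_orbit f x q ^+ 2)%:E)%E).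
    by apply: integrableD => //; exact: ifs.
  by apply/funext => x; rewrite /= EFinD.
Qed.

(** For F = f + i g, the real part of the integral of F shifted by (d, 0) times the conjugate of
    F. *)
Definition correlation f g d : R :=
  Rintegral mu setT (fun x => shift_orbit f x d * f x + shift_orbit g x d * g x).

Lemma integrable_shift_mulD f g p q : square_integrable f -> square_integrable g ->
  mu.-integrable setT (EFin \o (fun x => shift_orbit f x p * shift_orbit f x q +
    shift_orbit g x p * shift_orbit g x q)).
Proof.
move=> hf hg; rewrite (_ : _ \o _ = fun x =>
  ((shift_orbit f x p * shift_orbit f x q)%:E + (shift_orbit g x p * shift_orbit g x q)%:E)%E).
  by apply: integrableD => //; exact: integrable_shift_mul.
by apply/funext => x; rewrite /= EFinD.
Qed.

Lemma shift_orbit0 f x : shift_orbit f x 0 = f x.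
Proof.
by rewrite /shift_orbit; congr f; apply/funext => -[j1 j2]; rewrite /zshift addr0.
Qed.

Lemma integral_shift_mulD f g p q : square_integrable f -> square_integrable g ->
  (\int[mu]_x (shift_orbit f x p * shift_orbit f x q +
    shift_orbit g x p * shift_orbit g x q)%:E = (correlation f g (dist p q))%:E)%E.
Proof.
move=> hf hg.
wlog qp : p q / (q <= p)%N.
  move=> H; case: (leqP q p) => [/H//|/ltnW/H].
  rewrite /dist addnC => <-; apply: eq_integral => x _.
  by rewrite mulrC [shift_orbit g x p * _]mulrC.
have i0 := integrable_shift_mulD (dist p q) 0 hf hg.
have ipq := integrable_shift_mulD p q hf hg.
rewrite /correlation /Rintegral fineK; last first.
  apply: integrable_fin_num => //.
  rewrite (_ : (fun x => _) = EFin \o (fun x => shift_orbit f x (dist p q) * shift_orbit f x 0 +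
      shift_orbit g x (dist p q) * shift_orbit g x 0))//.
  by apply/funext => x; rewrite /= !shift_orbit0.
pose h (x : bconfig) := (shift_orbit f x (dist p q) * f x + shift_orbit g x (dist p q) * g x)%:E.
have hE x : (shift_orbit f x p * shift_orbit f x q + shift_orbit g x p * shift_orbit g x q)%:E =
    h (zshift (q%:Z, 0) x).
  rewrite /h /shift_orbit !zshiftD /dist (eqP qp) addn0.
  by rewrite (_ : (q%:Z, 0) + ((p - q)%N%:Z, 0) = (p%:Z, 0))//; congr (_, _); rewrite /=; lia.
transitivity (\int[mu]_x h (zshift (q%:Z, 0%R) x))%E.
  by apply: eq_integral => x _; rewrite hE.
have mh : measurable_fun setT h.
  have [mf _] := hf; have [mg _] := hg.
  apply/measurable_EFinP; apply: measurable_funD; apply: measurable_funM => //;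
    exact: measurable_shift_orbit.
rewrite -[LHS](integral_pushforward (measurable_zshift (q%:Z, 0)) (mu := mu) (D := setT) mh)//.
  by apply: eq_measure_integral; [exact: measurable_zshift|move=> ? A mA _; exact: mu_inv].
rewrite preimage_setT; rewrite (_ : h \o _ = EFin \o (fun x => shift_orbit f x p * shift_orbit f x q +
    shift_orbit g x p * shift_orbit g x q))//.
by apply/funext => x; rewrite /= hE.
Qed.

End SpectralIsometry.

Section SpectralVanishing.
Local Open Scope classical_set_scope.
Local Open Scope ring_scope.
Local Open Scope complex_scope.
Variables (R : realType) (mu : probability bconfig R).
Hypothesis mu_inv : forall (k : int * int) (B : set bconfig), measurable B ->
  mu (zshift k @^-1` B) = mu B.
Variables (F : bconfig -> R[i]) (s : {finite_measure set (R * R)%type -> \bar R}).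
Hypotheses (F2 : L2 mu F) (Fs : spectral_measure mu F s).
Let f x := complex.Re (F x).
Let g x := complex.Im (F x).

Lemma spectral_correlation d :
  Rintegral s setT (fun t : R * R => cosn d t.1) = correlation mu f g d.
Proof.
(* At k = (-d, 0) the character is z_1^d. Real parts suffice, since the polynomials have real
   coefficients. *)
have [_ /(_ (- d%:Z, 0))] := Fs; move=> /(congr1 (@complex.Re R)) /= e.
transitivity (Rintegral s setT (fun t : R * R =>
    complex.Re (circle_pt t.1 ^ (- - d%:Z) * circle_pt t.2 ^ (- 0)))).
  apply: eq_Rintegral => t _; rewrite opprK oppr0 expr0z mulr1 -exprnP.
  by rewrite circle_ptX.
rewrite e; apply: eq_Rintegral => x _.
rewrite (_ : - (- d%:Z, 0) = (d%:Z, 0)); last first.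
  by congr (_, _); rewrite /= ?opprK ?oppr0.
rewrite /shift_orbit /f /g; case: (F (zshift _ x)) (F x) => [a b] [a' b'] /=.
by rewrite mulrN opprK.
Qed.

(** The squared modulus of a real polynomial is a combination of cosines of the differences of
    exponents, and by invariance the correlations also depend only on these differences. *)
Lemma spectral_isometry N :
  (\int[s]_t (opQ N N (fun k => cosn k t.1) ^+ 2 + opQ N N (fun k => sinn k t.1) ^+ 2)%:E =
   energy mu N f + energy mu N g)%E.
Proof.
have [hf hg] := L2_square_integrable F2; rewrite -/f -/g in hf hg.
have [l hl] := @opQ_comb R N N.
pose r (z : (R * nat) * (R * nat)) := correlation mu f g (dist z.1.2 z.2.2).
pose c (z : (R * nat) * (R * nat)) := z.1.1 * z.2.1.
transitivity (\sum_(z <- pairs l) c z * r z)%:E.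
  rewrite -(integral_lincomb (m := s) (D := setT) (pairs l) c
    (h := fun z t => cosn (dist z.1.2 z.2.2) t.1))//.
  - apply: eq_integral => t _; rewrite !hl.
    rewrite (sqr_pairs l (fun k => cosn k t.1) (fun k => sinn k t.1)); congr EFin.
    by apply: eq_bigr => z _; rewrite cosn_dist.
  - move=> z; apply: measurable_bounded_integrable => //.
    + exact: fin_num_fun_lty.
    + apply: measurableT_comp => //; exact: measurable_cosn.
    + exact: cosn_bounded.
  - move=> z; rewrite /r -spectral_correlation /Rintegral fineK//.
    apply: integrable_fin_num => //; apply: measurable_bounded_integrable => //.
    + exact: fin_num_fun_lty.
    + apply: measurableT_comp => //; exact: measurable_cosn.
    + exact: cosn_bounded.
have [mf _] := hf; have [mg _] := hg.
rewrite /energy -ge0_integralD//; last 4 first.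
- by move=> x _; rewrite lee_fin sqr_ge0.
- exact: measurable_sqr_opQ.
- by move=> x _; rewrite lee_fin sqr_ge0.
- exact: measurable_sqr_opQ.
rewrite -(integral_lincomb (m := mu) (D := setT) (pairs l) c (h := fun z x =>
  shift_orbit f x z.1.2 * shift_orbit f x z.2.2 +
  shift_orbit g x z.1.2 * shift_orbit g x z.2.2))//.
- by apply: eq_integral => x _; rewrite !hl -EFinD sqr_pairs.
- by move=> z; exact: integrable_shift_mulD.
- by move=> z; rewrite integral_shift_mulD.
Qed.

Hypothesis mu_full : mu (subshift table) = 1%E.

Lemma spectral_vanishing (e : R) : 0 < e -> exists N0, forall N, (N0 <= N)%N ->
  (\int[s]_t (opQ N N (fun k => cosn k t.1) ^+ 2 + opQ N N (fun k => sinn k t.1) ^+ 2)%:E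
   <= e%:E)%E.
Proof.
move=> e0; have e2 : 0 < e / 2 by rewrite divr_gt0.
have [[mf f2] [mg g2]] := L2_square_integrable F2.
have [_ /(_ _ e2)[N1 h1]] := vanishing_L2 mu_inv mu_full mf f2.
have [_ /(_ _ e2)[N2 h2]] := vanishing_L2 mu_inv mu_full mg g2.
exists (maxn N1 N2) => N; rewrite geq_max => /andP[/h1 {}h1 /h2 {}h2].
by rewrite spectral_isometry (splitr e) EFinD leeD.
Qed.

End SpectralVanishing.

(** * Size of the polynomials for Lebesgue measure *)

Section LebesgueSide.
Local Open Scope classical_set_scope.
Local Open Scope ring_scope.
Variable R : realType.
Local Notation leb := (@lebesgue_measure R).

(** [cosn] and [sinn] are the real and imaginary parts of z^k, on which the shift is multiplication
    by z; with P = x + i y this is multiplicativity of the modulus for (P - 1)(P + 1/15). *)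
Lemma opQ_trig s N (t : R) : (0 < N)%N ->
  opQ s N (fun k => cosn k t) ^+ 2 + opQ s N (fun k => sinn k t) ^+ 2 =
  ((opP s N (fun k => cosn k t) - 1) ^+ 2 + opP s N (fun k => sinn k t) ^+ 2) *
  ((opP s N (fun k => cosn k t) + 15^-1) ^+ 2 + opP s N (fun k => sinn k t) ^+ 2).
Proof.
move=> N0; set x := opP s N _; set y := opP s N _.
have cD k i : cosn (k + i) t = cosn k t * cosn i t + - sinn k t * sinn i t.
  by rewrite /cosn /sinn natrD mulrDl cosD mulNr.
have sD k i : sinn (k + i) t = sinn k t * cosn i t + cosn k t * sinn i t.
  by rewrite /cosn /sinn natrD mulrDl sinD.
have c0 : cosn 0 t = 1 by rewrite /cosn mul0r cos0.
have s0 : sinn 0 t = 0 by rewrite /sinn mul0r sin0.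
have Pc k : opP_c s N (fun i => cosn (k + i) t) = (x + 15^-1) * cosn k t + - y * sinn k t.
  rewrite /opP_c addn0 (_ : (fun i => _) = fun i =>
    cosn k t * cosn i t + - sinn k t * sinn i t); last by apply/funext => i; exact: cD.
  by rewrite opPD !opPZ -/x -/y; ring.
have Ps k : opP_c s N (fun i => sinn (k + i) t) = (x + 15^-1) * sinn k t + y * cosn k t.
  rewrite /opP_c addn0 (_ : (fun i => _) = fun i =>
    sinn k t * cosn i t + cosn k t * sinn i t); last by apply/funext => i; exact: sD.
  by rewrite opPD !opPZ -/x -/y; ring.
have Pc0 := Pc 0%N; have Ps0 := Ps 0%N.
rewrite /opQ; under [fun k => opP_c _ _ _]eq_fun do rewrite Pc.
under [in X in _ + X]eq_fun do rewrite Ps.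
rewrite !opPD !opPZ -/x -/y Pc0 Ps0 c0 s0; ring.
Qed.

(** If |P| <= 1/30, the factors have moduli at least 29/30 and 1/30, and (29/900)^2 > 1/1000. *)
Lemma trig_lower (x y : R) : x ^+ 2 + y ^+ 2 <= 900^-1 ->
  1000^-1 <= ((x - 1) ^+ 2 + y ^+ 2) * ((x + 15^-1) ^+ 2 + y ^+ 2).
Proof.
move=> xy; have x30 : - 30^-1 <= x <= 30^-1.
  by apply/andP; split; rewrite leNgt; apply/negP => h; have := sqr_ge0 y; rewrite !expr2 in xy *; nra.
have h1 : (29 / 30) ^+ 2 <= (x - 1) ^+ 2 + y ^+ 2.
  by have := sqr_ge0 y; rewrite !expr2; case/andP: x30 => *; nra.
have h2 : 30^-1 ^+ 2 <= (x + 15^-1) ^+ 2 + y ^+ 2.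
  by have := sqr_ge0 y; rewrite !expr2; case/andP: x30 => *; nra.
apply: le_trans (ler_pM _ _ h1 h2); rewrite ?sqr_ge0//.
by rewrite -exprMn expr2; lra.
Qed.

Lemma integral_cosn d : (\int[leb]_(t in `[0%R, 1%R]) (cosn d t)%:E = ((d == 0)%N%:R)%:E)%E.
Proof.
case: d => [|d].
  under eq_integral do rewrite /cosn mul0r cos0.
  rewrite integral_cst//= lebesgue_measure_itv/= lte_fin ltr01 mul1e.
  by rewrite oppr0 adde0.
pose w : R := d.+1%:R * (2 * pi).
have w0 : w != 0 by rewrite !mulf_neq0 ?pnatr_eq0// gt_eqF// pi_gt0.
have dF (t : R) : is_derive t 1 (fun t => w^-1 * sin (w * t)) (cos (w * t)).
  have h1 : is_derive t 1 ( *%R w) w.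
    by have := is_deriveZ w (is_derive_id t (1 : R)); rewrite /GRing.scale /= mulr1.
  have h2 : is_derive t 1 (sin \o *%R w) (w * cos (w * t)).
    by have := is_derive1_comp (is_derive_sin (w * t)) h1; rewrite mulrC.
  by have := is_deriveZ w^-1 h2; rewrite /GRing.scale /= mulKf.
have cF : continuous (fun t : R => w^-1 * sin (w * t) : R).
  move=> t; apply: differentiable_continuous; apply/derivable1_diffP.
  by have [] := dF t.
have cosE t : cosn d.+1 t = cos (w * t) by rewrite /cosn /w mulrA.
have ccos : continuous (@cosn R d.+1).
  move=> t; rewrite (_ : cosn d.+1 = cos \o *%R w); last by apply/funext => u; exact: cosE.
  by apply: continuous_comp; [exact: mulrl_continuous|exact: continuous_cos].
rewrite (@continuous_FTC2 _ (cosn d.+1) (fun t => w^-1 * sin (w * t)) 0 1)//.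
- rewrite mulr1 mulr0 sin0 mulr0 (_ : sin w = 0) ?mulr0 ?sube0//.
  rewrite /w; elim: d.+1 => [|k IH]; first by rewrite mul0r sin0.
  by rewrite -natr1 mulrDl mul1r [2 * pi]mulr_natl sinD2pi -[pi *+ 2]mulr_natl.
- exact: continuous_subspaceT.
- split; first by move=> t _; have [] := dF t.
    by apply: cvg_at_right_filter; exact: cF.
  by apply: cvg_at_left_filter; exact: cF.
- by move=> t _; rewrite derive1E cosE; have [] := dF t.
Qed.

(** Parseval: the N exponents are distinct powers of 2 and each coefficient is 1/N. *)
Lemma integral_opP_trig s N : (0 < N)%N ->
  (\int[leb]_(t in `[0%R, 1%R]) (opP s N (fun k => cosn k t) ^+ 2 +
     opP s N (fun k => sinn k t) ^+ 2)%:E = (N%:R^-1)%:E)%E.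
Proof.
move=> N0; pose l : seq (R * nat) := [seq (N%:R^-1, (2 ^ (s + n))%N) | n <- index_iota 0 N].
have hl (f : nat -> R) : opP s N f = \sum_(p <- l) p.1 * f p.2.
  by rewrite big_map /opP mulr_suml; apply: eq_bigr => n _; rewrite mulrC.
pose c (z : (R * nat) * (R * nat)) := z.1.1 * z.2.1.
transitivity (\sum_(z <- pairs l) c z * (dist z.1.2 z.2.2 == 0)%N%:R)%:E.
  rewrite -(integral_lincomb (m := leb) (D := `[0%R, 1%R]) (pairs l) c
    (h := fun z t => cosn (dist z.1.2 z.2.2) t))//.
  - apply: eq_integral => t _; rewrite !hl.
    rewrite (sqr_pairs l (fun k => cosn k t) (fun k => sinn k t)); congr EFin.
    by apply: eq_bigr => z _; rewrite cosn_dist.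
  - move=> z; apply: measurable_bounded_integrable => //.
    + by rewrite /= lebesgue_measure_itv/= lte_fin ltr01 -EFinD ltry.
    + by apply: measurable_funTS; exact: measurable_cosn.
    + exact: cosn_bounded.
  - by move=> z; exact: integral_cosn.
congr EFin; rewrite /pairs big_allpairs_dep /l !big_map.
transitivity (\sum_(0 <= n < N) (N%:R^-1 * N%:R^-1 : R)).
  apply: eq_big_nat => n /andP[_ hn]; rewrite big_map.
  rewrite (bigD1_seq n) ?mem_index_iota ?iota_uniq//= big1 ?addr0.
    by rewrite /dist subnn mulr1.
  move=> p pn; rewrite (_ : (dist _ _ == 0)%N = false) ?mulr0//.
  apply/negbTE; rewrite /dist addn_eq0 !subn_eq0 -eqn_leq eqn_exp2l// eqn_add2l.
  by rewrite eq_sym.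
rewrite sumr_const_nat subn0 -[(_ * _) *+ _]mulr_natr -mulrA mulVf ?mulr1//.
by rewrite pnatr_eq0 -lt0n.
Qed.

Lemma markov_ge0 d (T : measurableType d) (m : {measure set T -> \bar R}) (D : set T)
    (h : T -> R) (a : R) : measurable D -> measurable_fun D h -> (forall x, 0 <= h x) ->
  0 < a -> (a%:E * m (D `&` [set x | (a <= h x)%R]) <= \int[m]_(x in D) (h x)%:E)%E.
Proof.
move=> mD mh h0 a0.
have := @le_integral_comp_abse _ _ _ m D mD (EFin \o h) a id
  (@measurable_id _ _ _) (fun _ => id) _ _ a0.
rewrite (_ : [set x | _] = [set x | a <= h x]); last first.
  by apply/seteqP; split => x /=; rewrite lee_fin ger0_norm.
under eq_integral do rewrite /= ger0_norm//.
apply; last exact/measurable_EFinP.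
by move=> x y.
Qed.


End LebesgueSide.

(** * The separating set *)

Section Singularity.
Local Open Scope classical_set_scope.
Local Open Scope ring_scope.
Variable R : realType.
Local Notation leb := (@lebesgue_measure R).

Definition trigQ N (t : R) : R :=
  opQ N N (fun k => cosn k t) ^+ 2 + opQ N N (fun k => sinn k t) ^+ 2.

Lemma measurable_trigQ N : measurable_fun setT (trigQ N).
Proof.
apply: measurable_funD; apply: measurable_funX.
  by apply: (measurable_opQ N N (h := @cosn R)) => k; exact: measurable_cosn.
by apply: (measurable_opQ N N (h := @sinn R)) => k; exact: measurable_sinn.
Qed.

Lemma lebesgue_trigQ_small N : (0 < N)%N ->
  (leb (`[0%R, 1%R[ `&` [set t | (trigQ N t < 1000^-1)%R]) <= (900 / N%:R)%:E)%E.
Proof.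
move=> N0; pose h t : R := opP N N (fun k => cosn k t) ^+ 2 + opP N N (fun k => sinn k t) ^+ 2.
have mh : measurable_fun setT h.
  apply: measurable_funD; apply: measurable_funX.
    by apply: (measurable_opP N N (h := @cosn R)) => k; exact: measurable_cosn.
  by apply: (measurable_opP N N (h := @sinn R)) => k; exact: measurable_sinn.
have mge (u : R -> R) (a : R) : measurable_fun setT u -> measurable [set t | a <= u t].
  move=> mu; rewrite (_ : [set t | _] = u @^-1` `[a, +oo[); last first.
    by apply/seteqP; split => t /=; rewrite in_itv/= andbT.
  by rewrite -[X in measurable X]setTI; exact: mu.
have mlt (u : R -> R) (a : R) : measurable_fun setT u -> measurable [set t | u t < a].
  move=> mu; rewrite (_ : [set t | _] = u @^-1` `]-oo, a[); last first.
    by apply/seteqP; split => t /=; rewrite in_itv/=.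
  by rewrite -[X in measurable X]setTI; exact: mu.
apply: (@le_trans _ _ (leb (`[0%R, 1%R] `&` [set t | 900^-1 <= h t]))).
  apply: le_measure; rewrite ?inE.
  - by apply: measurableI => //; apply: mlt; exact: measurable_trigQ.
  - by apply: measurableI => //; exact: mge.
  - move=> t /= [t01 tQ]; split.
      by move: t01; rewrite !in_itv/= => /andP[-> /ltW].
    rewrite leNgt; apply/negP => /ltW /trig_lower; rewrite -opQ_trig// leNgt.
    by rewrite -/(trigQ N t) tQ.
have h0 t : 0 <= h t by rewrite addr_ge0 ?sqr_ge0.
have a0 : 0 < 900^-1 :> R by lra.
have mI : measurable (`[0%R, 1%R] : set R) by [].
have := @markov_ge0 R _ _ leb _ h 900^-1 mI (measurable_funTS mh) h0 a0.
rewrite integral_opP_trig// => H.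
rewrite EFinM.
apply: le_trans (lee_wpmul2l _ H); last by rewrite lee_fin; lra.
have n0 : (900 : R) != 0 by apply: lt0r_neq0; lra.
by rewrite muleA -EFinM (mulfV n0) mul1e.
Qed.

Lemma singular_of_trigQ (s sF : {finite_measure set (R * R)%type -> \bar R}) :
  s `<< sF ->
  (forall e : R, 0 < e -> exists N0, forall N, (N0 <= N)%N ->
     (\int[sF]_t (trigQ N t.1)%:E <= e%:E)%E) ->
  mutually_singular s (@torus_lebesgue R).
Proof.
move=> ssF van.
(* Along this subsequence the masses in Borel-Cantelli are bounded by 2^-(j+1), whose sum is 1. *)
have /choice[N hN] (j : nat) : exists N, [/\ (0 < N)%N, 900 / N%:R <= 1 / (2 ^ j.+1)%:R :> R &
    (\int[sF]_t (trigQ N t.1)%:E <= (1000^-1 * (1 / (2 ^ j.+1)%:R))%:E)%E].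
  have e0 : 0 < 1 / (2 ^ j.+1)%:R :> R by rewrite divr_gt0// ltr0n expn_gt0.
  have a0 : 0 < 1000^-1 :> R by lra.
  have [N1 h1] := van _ (mulr_gt0 a0 e0).
  have [N2 N20 h2] := eventually_small (c := 900) (ler0n _ _) e0.
  exists (maxn N1 N2); split.
  - by rewrite leq_max N20 orbT.
  - by have [] := h2 (maxn N1 N2) (leq_maxr _ _).
  - by apply: h1; exact: leq_maxl.
pose E j : set R := [set t | 1000^-1 <= trigQ (N j) t].
have mE j : measurable (E j).
  rewrite (_ : E j = trigQ (N j) @^-1` `[1000^-1, +oo[); last first.
    by apply/seteqP; split => t /=; rewrite in_itv/= andbT.
  by rewrite -[X in measurable X]setTI; exact: measurable_trigQ.
pose G j : set (R * R) := fst @^-1` E j.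
have mG j : measurable (G j).
  by rewrite -[X in measurable X]setTI; apply: (measurable_fst measurableT); exact: mE.
have sG j : (sF (G j) <= (1 / (2 ^ j.+1)%:R)%:E)%E.
  have [N0 _ I1] := hN j.
  have mt : measurable_fun setT (fun t : R * R => trigQ (N j) t.1).
    by apply: measurableT_comp => //; exact: measurable_trigQ.
  have t0 (t : R * R) : 0 <= trigQ (N j) t.1 by rewrite addr_ge0 ?sqr_ge0.
  have a0 : 0 < 1000^-1 :> R by lra.
  have := le_trans (@markov_ge0 R _ _ sF setT _ _ measurableT mt t0 a0) I1.
  by rewrite setTI EFinM lee_pmul2l.
have mLS : measurable (lim_sup_set G).
  by apply: bigcapT_measurable => n; exact: bigcup_measurable.
exists (lim_sup_set G); split => //.
  have /null_content_dominatesP := ssF; apply => //.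
  apply: lim_sup_set_cvg0 => //.
  apply: (@le_lt_trans _ _ 1%:E); last exact: ltry.
  apply: le_trans (epsilon_trick0 xpredT (ler01 : 0 <= 1 :> R)).
  by apply: lee_nneseries => // j _; exact: sG.
rewrite /torus_lebesgue.
(* Off the upper limit of the [G j], the first coordinate satisfies all inequalities trigQ < 1/1000
   from some index n on; [C n] is null, being contained in sets of measure at most 900 / N j, which
   tends to 0. *)
pose C n : set R := \bigcap_(j >= n) (`[0%R, 1%R[ `&` [set t | trigQ (N j) t < 1000^-1]).
have CE j : `[0%R, 1%R[ `&` [set t | trigQ (N j) t < 1000^-1] = `[0%R, 1%R[ `\` E j :> set R.
  by apply/seteqP; split => t [t01 h]; split => //; move: h; rewrite /E /= real_ltNge ?num_real// => /negP.
have mC n : measurable (C n).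
  by apply: bigcap_measurable; [exists n => /=|move=> j _; rewrite CE; exact: measurableD].
have C0 n : leb (C n) = 0%E.
  apply/eqP; rewrite eq_le measure_ge0 andbT; apply/lee_addgt0Pr => e e0.
  have [n0 _ he] := eventually_small (c := 1) ler01 e0.
  have [N0 h1 _] := hN (maxn n n0).
  rewrite add0e; apply: (@le_trans _ _ (leb (`[0%R, 1%R[ `&` [set t | trigQ (N (maxn n n0)) t < 1000^-1]))).
    apply: le_measure; rewrite ?inE; [exact: mC|rewrite CE|].
      by apply: measurableD; [exact: measurable_itv|exact: mE].
    by move=> t; apply; exact: leq_maxl.
  apply: le_trans (lebesgue_trigQ_small N0) _; rewrite lee_fin; apply: le_trans h1 _.
  have [_ ] := he (maxn n n0).+1 (leq_trans (leq_maxr _ _) (leqnSn _)).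
  by rewrite natrX exprVn.
apply/negligibleP.
  by apply: measurableI; [exact: measurableC|exact: measurableX].
have sub : ~` lim_sup_set G `&` torus `<=` \bigcup_n (C n `*` `[0%R, 1%R[).
  move=> t [/existsNP[n /not_implyP[_ nG]] [t1 t2]]; exists n => //; split => // j nj; split => //=.
  by rewrite real_ltNge ?num_real//; apply/negP => h; apply: nG; exists j.
apply: negligibleS; first exact: sub.
apply: negligible_bigcup => n; apply/negligibleP; first by apply: measurableX; [exact: mC|exact: measurable_itv].
have := @product_measure1E _ _ _ _ R leb leb (C n) `[0%R, 1%R[ (mC n) (measurable_itv _).
move=> e; apply: (etrans e); rewrite -[X in (X * _)%E]/(leb (C n)) C0.
exact: mul0e.
Qed.

End Singularity.

Theorem mainTheorem9 (R : realType) (mu : probability bconfig R)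
    (hmu : invariant_probability_on (subshift table) mu)
    (s : {finite_measure set (R * R)%type -> \bar R}%R)
    (hs : in_maximal_spectral_type mu s) :
  mutually_singular s (@torus_lebesgue R).
Proof.
have [mu_full mu_inv] := hmu.
have [_ [F [sF [F2 Fs _ ssF _]]]] := hs.
apply: singular_of_trigQ ssF _ => e e0.
exact: (spectral_vanishing mu_inv F2 Fs mu_full e0).
Qed.
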